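(* Let $A$ and $B$ be C*-algebras and let $(\mathsf{X}, \varphi)$ be an $(A,B)$ C*-correspondence. Then, for any nondegenerate representation $\rho_B$ of $B$ on a Hilbert space $\mathcal{H}_0$, there are a representation $\lambda_A\colon A \to \mathcal{L}(\mathcal{H}_1)$ of $A$ on a Hilbert space $\mathcal{H}_1$ and a bounded linear map $\pi_{\mathsf{X}} \colon \mathsf{X} \to \mathcal{L}(\mathcal{H}_0, \mathcal{H}_1)$ such that $(\lambda_A, \rho_B, \pi_{\mathsf{X}})$ is a representation of $(\mathsf{X}, \varphi)$ on $(\mathcal{H}_0, \mathcal{H}_1)$. If in addition $A$ acts nondegenerately on $\mathsf{X}$, then $\lambda_A$ is nondegenerate.
   Context: $\mathcal{L}(\mathcal{H}_0,\mathcal{H}_1)$ is the space of bounded linear maps between Hilbert spaces $\mathcal{H}_0$ and $\mathcal{H}_1$, and $\mathcal{L}(\mathcal{H})=\mathcal{L}(\mathcal{H},\mathcal{H})$. A representation of a C*-algebra on $\mathcal{H}$ is a $*$-homomorphism into $\mathcal{L}(\mathcal{H})$. Inner products of right Hilbert $B$-modules, written $\langle -,-\rangle_B$, are linear in the second variable and conjugate linear in the first. $\mathcal{L}_B(\mathsf{X})$ denotes the C*-algebra of adjointable maps $\mathsf{X}\to\mathsf{X}$. An $(A,B)$ C*-correspondence is a pair $(\mathsf{X},\varphi)$ where $\mathsf{X}$ is a right Hilbert $B$-module and $\varphi\colon A\to\mathcal{L}_B(\mathsf{X})$ is a $*$-homomorphism. $A$ acts nondegenerately on $\mathsf{X}$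 if $\varphi(A)\mathsf{X}$ (the linear span of the elements $\varphi(a)x$) is dense in $\mathsf{X}$. A representation of an $(A,B)$ C*-correspondence $(\mathsf{X},\varphi)$ on a pair of Hilbert spaces $(\mathcal{H}_0,\mathcal{H}_1)$ is a triple $(\lambda_A,\rho_B,\pi_{\mathsf{X}})$ where $\lambda_A$ is a representation of $A$ on $\mathcal{H}_1$, $\rho_B$ is a representation of $B$ on $\mathcal{H}_0$, and $\pi_{\mathsf{X}}\colon\mathsf{X}\to\mathcal{L}(\mathcal{H}_0,\mathcal{H}_1)$ is a linear map such that for all $a\in A$, $b\in B$, $x,y\in\mathsf{X}$: (1) $\pi_{\mathsf{X}}(\varphi(a)x)=\lambda_A(a)\pi_{\mathsf{X}}(x)$; (2) $\pi_{\mathsf{X}}(xb)=\pi_{\mathsf{X}}(x)\rho_B(b)$; (3) $\rho_B(\langle x,y\rangle_B)=\pi_{\mathsf{X}}(x)^*\pi_{\mathsf{X}}(y)$. *)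

(* Defs.v *)
From HB Require Import structures.
From mathcomp Require Import all_boot all_order all_algebra.
From mathcomp Require Import all_classical all_reals all_analysis.
From mathcomp Require Import complex.
From mathcomp Require Import ring.

Set Implicit Arguments.
Unset Strict Implicit.
Unset Printing Implicit Defensive.

Import Order.TTheory GRing.Theory Num.Theory.
Import numFieldNormedType.Exports.

Local Open Scope classical_set_scope.
Local Open Scope complex_scope.
Local Open Scope ring_scope.

(* Complex *-algebras. They need not be unital, so MathComp's (unital) rings
   cannot be used. *)
HB.mixin Record Lmodule_isStarAlgebra (R : realType) A
    & GRing.Lmodule R[i] A := {
  amul : A -> A -> A;
  star : A -> A;
  amulA : forall a b c, amul a (amul b c) = amul (amul a b) c;
  amulDl : forall a b c, amul (a + b) c = amul a c + amul b c;
  amulDr : forall a b c, amul a (b + c) = amul a b + amul a c;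
  amulZl : forall (k : R[i]) a b, amul (k *: a) b = k *: amul a b;
  amulZr : forall (k : R[i]) a b, amul a (k *: b) = k *: amul a b;
  starK : forall a, star (star a) = a;
  starD : forall a b, star (a + b) = star a + star b;
  starZ : forall (k : R[i]) a, star (k *: a) = k^* *: star a;
  starM : forall a b, star (amul a b) = amul (star b) (star a)
}.

#[short(type="starAlgType")]
HB.structure Definition StarAlgebra (R : realType) :=
  {A of GRing.Lmodule R[i] A & Lmodule_isStarAlgebra R A}.

HB.mixin Record StarAlgebra_isCstarAlgebra (R : realType) A
    & StarAlgebra R A & CompleteNormedModule R[i] A := {
  normM_le : forall a b : A, `|amul a b| <= `|a| * `|b|;
  cstar_id : forall a : A, `|amul (star a) a| = `|a| ^+ 2
}.

#[short(type="cstarAlgType")]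
HB.structure Definition CstarAlgebra (R : realType) :=
  {A of StarAlgebra R A & CompleteNormedModule R[i] A
      & StarAlgebra_isCstarAlgebra R A}.

Definition star_hom (R : realType) (A B : starAlgType R) (f : A -> B) :=
  [/\ linear f,
      forall a b, f (amul a b) = amul (f a) (f b) &
      forall a, f (star a) = star (f a)].

(* In a C*-algebra this amounts to being self-adjoint with nonnegative
   spectrum. *)
Definition star_positive (R : realType) (A : starAlgType R) (a : A) :=
  exists c : A, a = amul (star c) c.

(* Positivity and definiteness of the inner product follow from hdot_norm. *)
HB.mixin Record CompleteNormedModule_isHilbert (R : realType) H
    & CompleteNormedModule R[i] H := {
  hdot : H -> H -> R[i];
  hdotDr : forall x y z, hdot x (y + z) = hdot x y + hdot x z;
  hdotZr : forall (k : R[i]) x y, hdot x (k *: y) = k * hdot x y;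
  hdotC : forall x y, hdot y x = (hdot x y)^*;
  hdot_norm : forall x, hdot x x = `|x| ^+ 2
}.

#[short(type="hilbertType")]
HB.structure Definition Hilbert (R : realType) :=
  {H of CompleteNormedModule R[i] H & CompleteNormedModule_isHilbert R H}.

(* Right Hilbert B-modules. Definiteness of the inner product follows from
   bdot_norm. *)
HB.mixin Record CompleteNormedModule_isHilbertModule (R : realType)
    (B : cstarAlgType R) X & CompleteNormedModule R[i] X := {
  ract : X -> B -> X;
  bdot : X -> X -> B;
  ractDl : forall x y b, ract (x + y) b = ract x b + ract y b;
  ractDr : forall x b c, ract x (b + c) = ract x b + ract x c;
  ractZl : forall (k : R[i]) x b, ract (k *: x) b = k *: ract x b;
  ractZr : forall (k : R[i]) x b, ract x (k *: b) = k *: ract x b;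
  ractM : forall x b c, ract x (amul b c) = ract (ract x b) c;
  bdotDr : forall x y z, bdot x (y + z) = bdot x y + bdot x z;
  bdotZr : forall (k : R[i]) x y, bdot x (k *: y) = k *: bdot x y;
  bdot_ract : forall x y b, bdot x (ract y b) = amul (bdot x y) b;
  bdotC : forall x y, bdot y x = star (bdot x y);
  bdot_ge0 : forall x, star_positive (bdot x x);
  bdot_norm : forall x, `|bdot x x| = `|x| ^+ 2
}.

#[short(type="hilbertModType")]
HB.structure Definition HilbertModule (R : realType) (B : cstarAlgType R) :=
  {X of CompleteNormedModule R[i] X
      & CompleteNormedModule_isHilbertModule R B X}.

Section HilbertTheory.
Variables (R : realType) (H : hilbertType R).
Implicit Types (x y z : H) (k : R[i]).

Lemma hdotDl x y z : hdot (x + y) z = hdot x z + hdot y z.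
Proof. by rewrite hdotC hdotDr rmorphD /= -!hdotC. Qed.

Lemma hdotZl k x y : hdot (k *: x) y = k^* * hdot x y.
Proof. by rewrite hdotC hdotZr rmorphM /= -hdotC. Qed.

Lemma hdot0r x : hdot x 0 = 0.
Proof. by rewrite -(scale0r (0 : H)) hdotZr mul0r. Qed.

Lemma hdot0l x : hdot 0 x = 0.
Proof. by rewrite hdotC hdot0r rmorph0. Qed.

Lemma hdotNr x y : hdot x (- y) = - hdot x y.
Proof. by rewrite -scaleN1r hdotZr mulN1r. Qed.

Lemma hdotNl x y : hdot (- x) y = - hdot x y.
Proof. by rewrite hdotC hdotNr rmorphN /= -hdotC. Qed.

Lemma hdotBr x y z : hdot x (y - z) = hdot x y - hdot x z.
Proof. by rewrite hdotDr hdotNr. Qed.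

Lemma hdotBl x y z : hdot (x - y) z = hdot x z - hdot y z.
Proof. by rewrite hdotDl hdotNl. Qed.

Lemma hdot_inj x y : (forall z, hdot z x = hdot z y) -> x = y.
Proof.
move=> xy; apply/eqP; rewrite -subr_eq0 -normr_eq0 -sqrf_eq0.
by rewrite -hdot_norm hdotBr xy subrr.
Qed.

Lemma hdot_injl x y : (forall z, hdot x z = hdot y z) -> x = y.
Proof. by move=> xy; apply: hdot_inj => z; rewrite hdotC xy -hdotC. Qed.

Lemma normB2 x y :
  `|x - y| ^+ 2 = `|x| ^+ 2 + `|y| ^+ 2 - (hdot x y + hdot y x).
Proof.
by rewrite -!hdot_norm hdotBl !hdotBr; ring.
Qed.

Lemma normD2 x y :
  `|x + y| ^+ 2 = `|x| ^+ 2 + `|y| ^+ 2 + (hdot x y + hdot y x).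
Proof. by rewrite -!hdot_norm hdotDl !hdotDr; ring. Qed.

Lemma parallelogram x y :
  `|x + y| ^+ 2 + `|x - y| ^+ 2 = (`|x| ^+ 2 + `|y| ^+ 2) *+ 2.
Proof. by rewrite normD2 normB2 addrACA subrr addr0 mulr2n. Qed.

Lemma cauchy_schwarz x y : `|hdot x y| <= `|x| * `|y|.
Proof.
have [->|x0] := eqVneq x 0; first by rewrite hdot0l !normr0 mul0r.
have nx : 0 < `|x| ^+ 2 by rewrite exprn_gt0 // normr_gt0.
rewrite -(@ler_pXn2r _ 2) ?nnegrE ?mulr_ge0 ?normr_ge0 //.
have n0 : `|x| ^+ 2 != 0 by rewrite gt_eqF.
set a := hdot x y; set b := hdot y x; set n := `|x| ^+ 2.
have ab : `|a| ^+ 2 = a * b by rewrite sqr_normc /b hdotC.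
pose k := a / n.
have kx : k^* = b / n.
  by rewrite /k rmorphM /= /b hdotC fmorphV /= /n -hdot_norm -hdotC.
have : 0 <= `|k *: x - y| ^+ 2 by rewrite exprn_ge0.
rewrite -hdot_norm !hdotBl !hdotBr !hdotZl !hdotZr kx !hdot_norm -/a -/b -/n.
have -> : b / n * (k * n) - b / n * a - (k * b - `|y| ^+ 2)
    = `|y| ^+ 2 - a * b / n by rewrite /k; field.
by rewrite subr_ge0 ler_pdivrMr // -ab exprMn mulrC.
Qed.

End HilbertTheory.

Lemma natSinv_ltC (R : realType) (e : R[i]) : 0 < e ->
  exists N, forall n, (N <= n)%N -> n.+1%:R^-1 < e.
Proof.
move=> e0; have eE : (complex.Re e)%:C = e by rewrite RRe_real // gtr0_real.
have re0 : 0 < complex.Re e by rewrite -ltcR eE.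
have [N _ NP] := near_infty_natSinv_lt (PosNum re0).
exists N => n /NP /= h.
by rewrite -eE -(rmorph_nat (real_complex R)) -fmorphV /= ltcR.
Qed.

Lemma le_epsC (R : realType) (a c : R[i]) : 0 <= a -> 0 <= c ->
  (forall e, 0 < e -> a <= c * e) -> a = 0.
Proof.
move=> a0 c0 h; apply/eqP; apply: contraT => an0.
have a_gt0 : 0 < a by rewrite lt_def an0.
have c1 : 0 < c + 1 by rewrite ltr_wpDl.
have := h (a / (c + 1)) (divr_gt0 a_gt0 c1).
rewrite mulrA ler_pdivlMr // mulrDr mulr1 [c * a]mulrC gerDl => a_le0.
by rewrite (lt_geF a_gt0) in a_le0.
Qed.

Section Riesz.
Variables (R : realType) (H : hilbertType R) (f : H -> R[i]) (M : R[i]).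
Hypothesis f_lin : forall k x y, f (k *: x + y) = k * f x + f y.
Hypothesis f_bnd : forall x, `|f x| <= M * `|x|.

Let fD x y : f (x + y) = f x + f y.
Proof. by rewrite -{1}[x]scale1r f_lin mul1r. Qed.

Let f0 : f 0 = 0.
Proof. by apply: (addrI (f 0)); rewrite -fD !addr0. Qed.

Let fZ k x : f (k *: x) = k * f x.
Proof. by rewrite -[k *: x]addr0 f_lin f0 addr0. Qed.

Let fB x y : f (x - y) = f x - f y.
Proof. by rewrite fD -scaleN1r fZ mulN1r. Qed.

Let K : set H := [set x | f x = 1].
Let E : set R := [set complex.Re (`|x| ^+ 2) | x in K].
Let d : R[i] := (inf E)%:C.

Let ReE (x : H) : (complex.Re (`|x| ^+ 2))%:C = `|x| ^+ 2.
Proof. by rewrite RRe_real // ger0_real // exprn_ge0. Qed.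

Let E_lb : lbound E 0.
Proof. by move=> _ [x Kx <-]; rewrite -lecR ReE exprn_ge0. Qed.

Let d_le x : K x -> d <= `|x| ^+ 2.
Proof.
move=> Kx; rewrite -ReE lecR; apply: ge_inf; last by exists x.
by exists 0.
Qed.

Let d_lt x0 : K x0 -> forall n, exists u, K u /\ `|u| ^+ 2 < d + n.+1%:R^-1.
Proof.
move=> Kx0 n.
have hE : has_inf E by split; [exists (complex.Re (`|x0| ^+ 2)), x0|exists 0].
have e0 : (0 : R) < n.+1%:R^-1 by rewrite invr_gt0 ltr0n.
have [_ [u Ku <-] lt] := inf_adherent e0 hE.
exists u; split => //.
by rewrite -ReE -(rmorph_nat (real_complex R)) -fmorphV /= -rmorphD ltcR.
Qed.

Let minseq_close u v (a b : R[i]) : K u -> K v ->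
  `|u| ^+ 2 < d + a -> `|v| ^+ 2 < d + b -> `|u - v| ^+ 2 < (a + b) *+ 2.
Proof.
move=> Ku Kv ua vb.
have Km : K (2^-1 *: (u + v)).
  by rewrite /K /= fZ fD Ku Kv mulVf // pnatr_eq0.
have := d_le Km; rewrite normrZ exprMn normfV ger0_norm ?ler0n // => dm.
have dm4 : d *+ 4 <= `|u + v| ^+ 2.
  rewrite -mulr_natr -ler_pdivlMr ?ltr0n //; apply: le_trans dm _.
  by rewrite mulrC exprVn -natrX.
have := parallelogram u v => /(canRL (addKr _)) ->.
rewrite addrC ltrBlDr; apply: (@lt_le_trans _ _ ((d + a + (d + b)) *+ 2)).
  by rewrite ltrMn2r /= ltrD.
have -> : (d + a + (d + b)) *+ 2 = (a + b) *+ 2 + d *+ 4 by ring.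
by rewrite lerD2l.
Qed.

(* u is nearly orthogonal to ker f. *)
Let almost_ortho u w (a : R[i]) : K u -> f w = 0 -> 0 <= a ->
  `|u| ^+ 2 < d + a -> `|hdot w u| ^+ 2 <= `|w| ^+ 2 * a.
Proof.
move=> Ku fw a0 ua.
have [->|w0] := eqVneq w 0.
  by rewrite hdot0l !normr0 expr0n mul0r.
have nw : 0 < `|w| ^+ 2 by rewrite exprn_gt0 // normr_gt0.
have n0 : `|w| ^+ 2 != 0 by rewrite gt_eqF.
set n := `|w| ^+ 2; set p := hdot w u; set q := hdot u w.
pose t := p / n.
have tq : t^* = q / n.
  by rewrite /t rmorphM /= /q hdotC fmorphV /= /n -hdot_norm -hdotC.
have pq : `|p| ^+ 2 = p * q by rewrite sqr_normc /q hdotC.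
have : d <= `|u - t *: w| ^+ 2 by apply: d_le; rewrite /K /= fB fZ fw mulr0 subr0.
rewrite -hdot_norm !hdotBl !hdotBr !hdotZl !hdotZr tq !hdot_norm -/p -/q -/n.
have -> : `|u| ^+ 2 - t * q - (q / n * p - q / n * (t * n)) = `|u| ^+ 2 - p * q / n.
  by rewrite /t; field.
rewrite -pq => h; rewrite mulrC -ler_pdivrMr //.
rewrite -(lerD2l d); apply: le_trans (ltW ua).
by rewrite -lerBrDr.
Qed.

Lemma riesz : exists y, forall x, f x = hdot y x.
Proof.
have [[x1 fx1]|h] := pselect (exists x, f x != 0); last first.
  exists 0 => x; rewrite hdot0l; apply/eqP; apply: contraT => fx.
  by case: h; exists x.
have Kx0 : K ((f x1)^-1 *: x1) by rewrite /K /= fZ mulVf.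
have [u uP] := choice (d_lt Kx0).
have nu n : `|u n| ^+ 2 < d + n.+1%:R^-1 by case: (uP n).
have Ku n : K (u n) by case: (uP n).
have : cauchy (u @ \oo).
  apply/cauchy_ballP => e e0.
  have e4 : 0 < e ^+ 2 / 4 by rewrite divr_gt0 ?exprn_gt0 ?ltr0n.
  have [N NP] := natSinv_ltC e4.
  exists ([set u n | n in [set n | (N <= n)%N]], [set u n | n in [set n | (N <= n)%N]]).
    by split => /=; exists N => // n /= Nn; exists n.
  case=> /= _ _ [[n Nn <-] [m Nm <-]].
  rewrite -ball_normE /ball_ /= -(@ltr_pXn2r _ 2) ?nnegrE ?(ltW e0) //.
  apply: lt_trans (minseq_close (Ku n) (Ku m) (nu n) (nu m)) _.
  have -> : e ^+ 2 = (e ^+ 2 / 4 + e ^+ 2 / 4) *+ 2 by field.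
  by rewrite ltrMn2r /= ltrD ?NP.
move=> /cauchy_cvg ucvg.
pose z := lim (u @ \oo).
have cu : u @ \oo --> z by exact: ucvg.
have uz (e : R[i]) : 0 < e -> exists N, forall n, (N <= n)%N -> `|z - u n| < e.
  move=> e0; have /cvgrPdist_lt/(_ e e0)[N _ NP] := cu.
  by exists N => n /NP.
have fz : f z = 1.
  apply/eqP; rewrite -subr_eq0 -normr_eq0; apply/eqP.
  have M0 : 0 <= M.
    have x1n : 0 < `|x1|.
      by rewrite normr_gt0; apply: contraNneq fx1 => ->; rewrite f0.
    by have := le_trans (normr_ge0 _) (f_bnd x1); rewrite pmulr_lge0.
  apply: (le_epsC _ M0) => // e e0; have [N /(_ N (leqnn _)) zN] := uz e e0.
  rewrite -(Ku N) -fB; apply: le_trans (f_bnd _) _.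
  by rewrite ler_wpM2l // ltW.
have zker w : f w = 0 -> hdot w z = 0.
  move=> fw; apply/eqP; rewrite -normr_eq0; apply/eqP.
  apply: (@le_epsC _ _ (`|w| *+ 2)) => [||e e0]; rewrite ?mulrn_wge0 //.
  have [N NP] := uz e e0; have [N' NP'] := natSinv_ltC (exprn_gt0 2 e0).
  pose n := maxn N N'.
  rewrite -[z](subrK (u n)) hdotDr; apply: le_trans (ler_normD _ _) _.
  rewrite mulrnAl mulr2n lerD //.
    apply: le_trans (cauchy_schwarz _ _) _.
    by rewrite ler_wpM2l // ltW // NP // leq_maxl.
  rewrite -(@ler_pXn2r _ 2) ?nnegrE ?mulr_ge0 ?(ltW e0) // exprMn.
  apply: le_trans (almost_ortho (Ku n) fw _ (nu n)) _.
    by rewrite invr_ge0 ler0n.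
  by rewrite ler_wpM2l ?exprn_ge0 // ltW // NP' // leq_maxr.
have z0 : `|z| ^+ 2 != 0.
  rewrite expf_eq0 /= normr_eq0; apply/eqP => z0.
  by have := fz; rewrite z0 f0 => /esym/eqP; rewrite oner_eq0.
exists (`|z| ^- 2 *: z) => x; rewrite hdotZl.
have /zker : f (x - f x *: z) = 0 by rewrite fB fZ fz mulr1 subrr.
rewrite hdotBl hdotZl hdot_norm => /eqP; rewrite subr_eq0 => /eqP xz.
have nJ : (`|z| ^+ 2)^* = `|z| ^+ 2 by rewrite -hdot_norm -hdotC.
have -> : hdot z x = f x * `|z| ^+ 2.
  by rewrite hdotC xz rmorphM /= conjCK nJ.
by rewrite fmorphV /= nJ mulrCA mulVf ?mulr1.
Qed.

End Riesz.

(* ||T|| <= M for the operator norm. *)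
Definition opnorm_le (R : realType) (V W : normedModType R[i])
  (T : V -> W) (M : R[i]) := forall x, `|T x| <= M * `|x|.

Section BoundedOp.
Variables (R : realType) (H0 H1 : hilbertType R).

Definition bounded_op : {pred (H0 -> H1)} :=
  mem [set T : H0 -> H1 | linear T /\ exists M : R[i], opnorm_le T M].

Lemma bounded_opP T :
  reflect (linear T /\ exists M : R[i], opnorm_le T M) (T \in bounded_op).
Proof. by apply: (iffP idP); rewrite inE. Qed.

Lemma bounded_op_submod_closed : submod_closed bounded_op.
Proof.
split; first by apply/bounded_opP; split => [k x y|];
  [rewrite scaler0 addr0|exists 0 => x; rewrite normr0 mul0r].
move=> k T S /bounded_opP[Tl [M TM]] /bounded_opP[Sl [N SN]].
apply/bounded_opP; split => [c x y|].
  rewrite !fctE /= Tl Sl !scalerDr !scalerA.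
  by rewrite mulrC addrACA.
exists (`|k| * M + N) => x; rewrite mulrDl -mulrA.
apply: le_trans (ler_normD _ _) _; apply: lerD => //.
by rewrite fctE normrZ ler_wpM2l.
Qed.

Record boundedOp := BoundedOp {
  boundedOp_fun :> H0 -> H1;
  boundedOp_subproof : boundedOp_fun \in bounded_op
}.

HB.instance Definition _ := [isSub for boundedOp_fun].
HB.instance Definition _ := [Choice of boundedOp by <:].
HB.instance Definition _ :=
  GRing.isSubmodClosed.Build _ _ bounded_op bounded_op_submod_closed.
HB.instance Definition _ :=
  [SubChoice_isSubLmodule of boundedOp by <:].

Lemma boundedOp_linear (T : boundedOp) : linear T.
Proof. by case/bounded_opP: (boundedOp_subproof T). Qed.

Lemma boundedOp_bounded (T : boundedOp) : exists M : R[i], opnorm_le T M.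
Proof. by case/bounded_opP: (boundedOp_subproof T). Qed.

HB.instance Definition _ (T : boundedOp) :=
  GRing.isLinear.Build R[i] H0 H1 _ T (boundedOp_linear T).

Lemma boundedOpP (S T : boundedOp) : S =1 T -> S = T.
Proof. by move=> /funext ST; apply: val_inj. Qed.

Lemma boundedOpDE (S T : boundedOp) x : (S + T) x = S x + T x.
Proof. by []. Qed.

Lemma boundedOpZE (k : R[i]) (T : boundedOp) x : (k *: T) x = k *: T x.
Proof. by []. Qed.

Lemma boundedOp_bound_ge0 (T : boundedOp) :
  exists2 M, 0 <= M & opnorm_le T M.
Proof.
have [M TM] := boundedOp_bounded T; exists `|M| => // x.
have := le_trans (normr_ge0 _) (TM x).
rewrite le_eqVlt => /predU1P[Mx0|Mx].
  by apply: le_trans (TM x) _; rewrite -Mx0 mulr_ge0.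
by rewrite -[X in _ * X]normr_id -normrM (ger0_norm (ltW Mx)).
Qed.

End BoundedOp.

Notation "''L' ( H0 , H1 )" := (boundedOp H0 H1)
  (at level 8, format "''L' ( H0 ,  H1 )") : type_scope.
Notation "''L' ( H )" := (boundedOp H H)
  (at level 8, format "''L' ( H )") : type_scope.

Section BoundedOpComp.
Variables (R : realType) (H0 H1 H2 : hilbertType R).
Variables (S : 'L(H1, H2)) (T : 'L(H0, H1)).

Lemma comp_op_subproof : (S \o T : H0 -> H2) \in @bounded_op R H0 H2.
Proof.
apply/bounded_opP; split => [k x y|]; first by rewrite /= !linearP.
have [M M0 SM] := boundedOp_bound_ge0 S; have [N TN] := boundedOp_bounded T.
exists (M * N) => x /=; apply: le_trans (SM _) _.
by rewrite -mulrA ler_wpM2l.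
Qed.

Definition comp_op : 'L(H0, H2) := BoundedOp comp_op_subproof.

End BoundedOpComp.

Section HilbertAdjoint.
Variables (R : realType) (H0 H1 : hilbertType R) (T : 'L(H0, H1)).

Lemma adjoint_ex : exists S : 'L(H1, H0),
  forall x y, hdot (T x) y = hdot x (S y).
Proof.
have [M M0 TM] := boundedOp_bound_ge0 T.
have rep y : exists s, forall x, hdot y (T x) = hdot s x.
  apply: (@riesz _ _ _ (`|y| * M)) => [k u v|x].
    by rewrite linearP hdotDr hdotZr.
  apply: le_trans (cauchy_schwarz _ _) _.
  by rewrite -mulrA ler_wpM2l.
have [S SP] := choice rep.
have SE x y : hdot (T x) y = hdot x (S y) by rewrite hdotC SP -hdotC.
suff SB : S \in @bounded_op R H1 H0 by exists (BoundedOp SB).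
apply/bounded_opP; split => [k x y|].
  by apply: hdot_inj => z; rewrite -SE hdotDr hdotZr !SE -hdotZr -hdotDr.
exists M => y; have [->|Sy0] := eqVneq (S y) 0.
  by rewrite normr0 mulr_ge0.
rewrite -(@ler_pM2l _ `|S y|) ?normr_gt0 // -expr2 -hdot_norm -SE.
have h : 0 <= hdot (T (S y)) y by rewrite SE hdot_norm exprn_ge0.
rewrite -(ger0_norm h); apply: le_trans (cauchy_schwarz _ _) _.
by rewrite mulrCA mulrA ler_wpM2r.
Qed.

Definition adjoint : 'L(H1, H0) := projT1 (cid adjoint_ex).

Lemma adjointE x y : hdot (T x) y = hdot x (adjoint y).
Proof. exact: (projT2 (cid adjoint_ex)). Qed.

Lemma adjoint_unique (S : 'L(H1, H0)) :
  (forall x y, hdot (T x) y = hdot x (S y)) -> S = adjoint.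
Proof.
by move=> SP; apply: boundedOpP => y; apply: hdot_inj => x; rewrite -SP adjointE.
Qed.

End HilbertAdjoint.

Section BoundedOpStar.
Variables (R : realType) (H : hilbertType R).
Implicit Types (S T U : 'L(H)) (k : R[i]).

Let compA S T U : comp_op S (comp_op T U) = comp_op (comp_op S T) U.
Proof. exact: boundedOpP. Qed.

Let compDl S T U : comp_op (S + T) U = comp_op S U + comp_op T U.
Proof. exact: boundedOpP. Qed.

Let compDr S T U : comp_op S (T + U) = comp_op S T + comp_op S U.
Proof. by apply: boundedOpP => x; exact: linearD. Qed.

Let compZl k S T : comp_op (k *: S) T = k *: comp_op S T.
Proof. exact: boundedOpP. Qed.

Let compZr k S T : comp_op S (k *: T) = k *: comp_op S T.
Proof. by apply: boundedOpP => x; exact: linearZ. Qed.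

Let adjK T : adjoint (adjoint T) = T.
Proof.
by apply/esym/adjoint_unique => x y; rewrite hdotC -adjointE -hdotC.
Qed.

Let adjD S T : adjoint (S + T) = adjoint S + adjoint T.
Proof.
apply/esym/adjoint_unique => x y.
by rewrite !boundedOpDE hdotDl hdotDr !adjointE.
Qed.

Let adjZ k T : adjoint (k *: T) = k^* *: adjoint T.
Proof.
apply/esym/adjoint_unique => x y.
by rewrite !boundedOpZE hdotZl hdotZr adjointE.
Qed.

Let adjM S T : adjoint (comp_op S T) = comp_op (adjoint T) (adjoint S).
Proof. by apply/esym/adjoint_unique => x y /=; rewrite !adjointE. Qed.

HB.instance Definition _ := Lmodule_isStarAlgebra.Build R 'L(H)
  compA compDl compDr compZl compZr adjK adjD adjZ adjM.

Lemma boundedOp_amulE S T x : amul S T x = S (T x).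
Proof. by []. Qed.

Lemma boundedOp_starE T : star T = adjoint T.
Proof. by []. Qed.

End BoundedOpStar.

Section HilbertModuleTheory.
Variables (R : realType) (B : cstarAlgType R) (X : hilbertModType B).
Implicit Types (x y z : X) (k : R[i]).

Lemma bdotDl x y z : bdot (x + y) z = bdot x z + bdot y z.
Proof. by rewrite bdotC bdotDr starD -!bdotC. Qed.

Lemma bdotZl k x y : bdot (k *: x) y = k^* *: bdot x y.
Proof. by rewrite bdotC bdotZr starZ -bdotC. Qed.

Lemma bdot_inj x y : (forall z, bdot z x = bdot z y) -> x = y.
Proof.
move=> xy; apply/eqP; rewrite -subr_eq0 -normr_eq0 -sqrf_eq0.
by rewrite -bdot_norm bdotDr -scaleN1r bdotZr xy !scaleN1r addrN normr0.
Qed.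

End HilbertModuleTheory.

Section AdjointableOp.
Variables (R : realType) (B : cstarAlgType R) (X : hilbertModType B).

Definition adjointable : {pred (X -> X)} :=
  mem [set T : X -> X | exists S : X -> X,
    forall x y, bdot (T x) y = bdot x (S y)].

Lemma adjointableP T :
  reflect (exists S : X -> X, forall x y, bdot (T x) y = bdot x (S y))
    (T \in adjointable).
Proof. by apply: (iffP idP); rewrite inE. Qed.

Lemma adjointable_submod_closed : submod_closed adjointable.
Proof.
split.
  apply/adjointableP; exists (fun=> 0) => x y.
  have -> : (0 : X -> X) x = 0 *: x by rewrite scale0r.
  by rewrite bdotZl -(scale0r y) bdotZr rmorph0 !scale0r.
move=> k T S /adjointableP[T' TT'] /adjointableP[S' SS'].
apply/adjointableP; exists (fun y => k^* *: T' y + S' y) => x y.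
by rewrite fctE bdotDl bdotZl bdotDr bdotZr TT' SS'.
Qed.

Record adjointableOp := AdjointableOp {
  adjointableOp_fun :> X -> X;
  adjointableOp_subproof : adjointableOp_fun \in adjointable
}.

HB.instance Definition _ := [isSub for adjointableOp_fun].
HB.instance Definition _ := [Choice of adjointableOp by <:].
HB.instance Definition _ :=
  GRing.isSubmodClosed.Build _ _ adjointable adjointable_submod_closed.
HB.instance Definition _ :=
  [SubChoice_isSubLmodule of adjointableOp by <:].

Implicit Types (S T U : adjointableOp) (k : R[i]).

Lemma adjointableOpP S T : S =1 T -> S = T.
Proof. by move=> /funext ST; apply: val_inj. Qed.

Lemma adjointableOpDE S T x : (S + T) x = S x + T x.
Proof. by []. Qed.

Lemma adjointableOpZE k T x : (k *: T) x = k *: T x.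
Proof. by []. Qed.

Lemma madjoint_ex T : exists S : adjointableOp,
  forall x y, bdot (T x) y = bdot x (S y).
Proof.
have /adjointableP[S TS] := adjointableOp_subproof T.
suff SA : S \in adjointable by exists (AdjointableOp SA).
by apply/adjointableP; exists T => x y; rewrite bdotC -TS -bdotC.
Qed.

Definition madjoint T : adjointableOp := projT1 (cid (madjoint_ex T)).

Lemma madjointE T x y : bdot (T x) y = bdot x (madjoint T y).
Proof. exact: (projT2 (cid (madjoint_ex T))). Qed.

Lemma madjoint_unique T S :
  (forall x y, bdot (T x) y = bdot x (S y)) -> S = madjoint T.
Proof.
by move=> SP; apply: adjointableOpP => y; apply: bdot_inj => x; rewrite -SP madjointE.
Qed.

Lemma adjointableOp_linear T : linear T.
Proof.
move=> k x y; apply: bdot_inj => z.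
have E u : bdot z (T u) = bdot (madjoint T z) u.
  by rewrite bdotC madjointE -bdotC.
by rewrite E bdotDr bdotZr -!E -bdotZr -bdotDr.
Qed.

HB.instance Definition _ T :=
  GRing.isLinear.Build R[i] X X _ T (adjointableOp_linear T).

Lemma mcomp_subproof S T : (S \o T : X -> X) \in adjointable.
Proof.
apply/adjointableP; exists (madjoint T \o madjoint S) => x y /=.
by rewrite !madjointE.
Qed.

Definition mcomp S T := AdjointableOp (mcomp_subproof S T).

Let compA S T U : mcomp S (mcomp T U) = mcomp (mcomp S T) U.
Proof. exact: adjointableOpP. Qed.

Let compDl S T U : mcomp (S + T) U = mcomp S U + mcomp T U.
Proof. exact: adjointableOpP. Qed.

Let compDr S T U : mcomp S (T + U) = mcomp S T + mcomp S U.
Proof.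
by apply: adjointableOpP => x; exact: linearD.
Qed.

Let compZl k S T : mcomp (k *: S) T = k *: mcomp S T.
Proof. exact: adjointableOpP. Qed.

Let compZr k S T : mcomp S (k *: T) = k *: mcomp S T.
Proof.
by apply: adjointableOpP => x; exact: linearZ.
Qed.

Let adjK T : madjoint (madjoint T) = T.
Proof.
by apply/esym/madjoint_unique => x y; rewrite bdotC -madjointE -bdotC.
Qed.

Let adjD S T : madjoint (S + T) = madjoint S + madjoint T.
Proof.
apply/esym/madjoint_unique => x y.
by rewrite !adjointableOpDE bdotDl bdotDr !madjointE.
Qed.

Let adjZ k T : madjoint (k *: T) = k^* *: madjoint T.
Proof.
apply/esym/madjoint_unique => x y.
by rewrite !adjointableOpZE bdotZl bdotZr madjointE.
Qed.

Let adjM S T : madjoint (mcomp S T) = mcomp (madjoint T) (madjoint S).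
Proof. by apply/esym/madjoint_unique => x y /=; rewrite !madjointE. Qed.

HB.instance Definition _ := Lmodule_isStarAlgebra.Build R adjointableOp
  compA compDl compDr compZl compZr adjK adjD adjZ adjM.

Lemma adjointableOp_amulE S T x : amul S T x = S (T x).
Proof. by []. Qed.

Lemma adjointableOp_starE T : star T = madjoint T.
Proof. by []. Qed.

End AdjointableOp.

Notation "''L_' B ( X )" := (@adjointableOp _ B X)
  (at level 8, B at level 2, format "''L_' B ( X )") : type_scope.

Definition lspan (K : numDomainType) (V : lmodType K) (S : set V) : set V :=
  [set v | exists n (c : 'I_n -> K) (s : 'I_n -> V),
    (forall i, S (s i)) /\ v = \sum_i c i *: s i].

(* For a representation of A on V = H this says that it is nondegenerate. *)
Definition acts_nondegenerately (R : realType) (A : Type)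
    (V : normedModType R[i]) (act : A -> V -> V) :=
  dense (lspan [set v | exists a x, v = act a x]).

Section Correspondence.
Variables (R : realType) (A B : cstarAlgType R).

Record correspondence := Correspondence {
  corr_module :> hilbertModType B;
  corr_act : A -> 'L_B(corr_module);
  corr_act_star_hom : star_hom corr_act
}.

Record corr_representation (X : correspondence) (H0 H1 : hilbertType R)
    (lam : A -> 'L(H1)) (rho : B -> 'L(H0)) (pi : X -> 'L(H0, H1)) : Prop :=
  CorrRepresentation {
    corr_rep_left : star_hom lam;
    corr_rep_right : star_hom rho;
    corr_rep_linear : linear pi;
    corr_rep_act : forall a x, pi (corr_act X a x) = comp_op (lam a) (pi x);
    corr_rep_ract : forall x b, pi (ract x b) = comp_op (pi x) (rho b);
    corr_rep_dot : forall x y,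
      rho (bdot x y) = comp_op (adjoint (pi x)) (pi y)
  }.

End Correspondence.

(* Main.v *)
Require Import Defs.
From HB Require Import structures.
From mathcomp Require Import all_boot all_order all_algebra.
From mathcomp Require Import all_classical all_reals all_analysis.
From mathcomp Require Import complex.
From mathcomp Require Import ring.

Set Implicit Arguments.
Unset Strict Implicit.
Unset Printing Implicit Defensive.

Import Order.TTheory GRing.Theory Num.Theory.
Import numFieldNormedType.Exports.

Local Open Scope classical_set_scope.
Local Open Scope complex_scope.
Local Open Scope ring_scope.

(** Why the theorem holds.  The Hilbert space H1 is the interior tensor product
    of X and H0: the completion of the span of symbols x (x) h for the form
    k((x, h), (y, h')) = <h, rho(<x, y>) h'>, on which A acts through the first
    factor, while pi(x) is the operator h |-> x (x) h.

    Positivity of k on finite families (interior_form_gram_ge0).  If all the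
    vectors h_i are of the form rho(b_i) h for one single h, the sum of the
    k((x_i, h_i), (x_j, h_j)) equals <h, rho(<z, z>) h> with z the sum of the
    x_i b_i; as <z, z> = d* d, this is |rho(d) h|^2.  In general, the subspace
    closure(rho(B) h_1) and its orthogonal complement reduce rho, so the sum
    splits into a part that is a limit of sums of the previous kind and the
    corresponding sum for the components orthogonal to rho(B) h_1.  Since rho is
    nondegenerate, h_1 lies in closure(rho(B) h_1), so its orthogonal component
    vanishes and the second sum has fewer terms: induction concludes.

    Boundedness of the action of A (gram_act_le).  For a self-adjoint b of norm
    less than 1, the fixed point equation c = (b + c^2)/2 has a self-adjoint
    solution, which reads 1 - b = (1 - c)^2 although A need not have a unit
    (selfadjoint_sqrt_one_minus).  Hence a functional g on A that is positive
    on the formal squares (1 - c)* (1 - c), with value m at the formal unit,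
    satisfies g(a* a) <= t^2 m for t > |a| (positive_functional_bound).  With
    g(b) = <v, b v> this bounds the action of A on finite sums v of symbols, and
    it also shows that representations of C*-algebras on Hilbert spaces are
    contractive, which bounds pi.

    Completion.  A positive definite kernel on a set G yields a Hilbert space
    of functions on G (Moore and Aronszajn): F stands for the vector whose inner
    product with the symbol g is F(g), and the functions retained are the limits,
    in the dual norm, of finite combinations of the symbols.  In this model,
    G being X * H0, an element a of A acts by (a F)(x, h) = F(a* x, h), so the
    identities to be verified become pointwise identities between functions.

    Nondegeneracy of the action of A passes from X to H1 because x (x) h depends
    continuously on x and the symbols x (x) h span a dense subspace. *)

(** * Limits and inequalities over the complex numbers *)

Lemma cauchy_seq_lim (K : numFieldType) (V : completeNormedModType K) (u : nat -> V) :
  (forall e : K, 0 < e -> exists N, forall n k, (N <= n)%N -> (N <= k)%N ->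
     `|u n - u k| < e) ->
  exists l, forall e : K, 0 < e -> exists N, forall n, (N <= n)%N -> `|u n - l| < e.
Proof.
move=> uC.
have : cauchy (u @ \oo).
  apply/cauchy_ballP => e e0; have [N NP] := uC e e0.
  exists ([set u n | n in [set n | (N <= n)%N]], [set u n | n in [set n | (N <= n)%N]]).
    by split => /=; exists N => // n /= Nn; exists n.
  case=> /= _ _ [[n Nn <-] [m Nm <-]].
  by rewrite -ball_normE /ball_ /= NP.
move=> /cauchy_cvg ucvg; exists (lim (u @ \oo)) => e e0.
have cu : u @ \oo --> lim (u @ \oo) by exact: ucvg.
have /cvgrPdist_lt/(_ e e0)[N _ NP] := cu.
by exists N => n /NP; rewrite distrC.
Qed.

Section ComplexScalars.
Variable R : realType.
Implicit Types (a b p q M : R[i]) (u : nat -> R[i]).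

Lemma natSinv_ge0 n : 0 <= n.+1%:R^-1 :> R[i].
Proof. by rewrite invr_ge0 ler0n. Qed.

Lemma le_natSinv a b M : 0 <= M ->
  (forall n, a <= b + M * n.+1%:R^-1) -> a <= b.
Proof.
move=> M0 h; apply/ler_addgt0Pr => e e0.
have M1 : 0 < M + 1 by rewrite ltr_wpDl.
have [N /(_ N (leqnn N)) NP] := natSinv_ltC (divr_gt0 e0 M1).
apply: le_trans (h N) _; rewrite lerD2l.
apply: (@le_trans _ _ ((M + 1) * N.+1%:R^-1)).
  by rewrite ler_wpM2r ?natSinv_ge0 // lerDl.
by rewrite mulrC -ler_pdivlMr // ltW.
Qed.

(** Completeness of the complex numbers, with the rate of convergence kept: the
    limits below are all taken along sequences that approximate at rate 1/n, and
    the rate is what makes their sums and conjugates immediate. *)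
Lemma cauchy_seq_limC u M : 0 <= M ->
  (forall n k, `|u n - u k| <= M * (n.+1%:R^-1 + k.+1%:R^-1)) ->
  exists l, forall n, `|u n - l| <= M * n.+1%:R^-1.
Proof.
move=> M0 uC.
have uC' (e : R) : 0 < e -> exists N, forall n k, (N <= n)%N -> (N <= k)%N ->
    `|u n - u k| < e%:C.
  move=> e0; have e0C : 0 < e%:C / (M + 1) / 2 :> R[i].
    by rewrite !divr_gt0 ?ltcR ?ltr_wpDl ?ltr0n.
  have [N NP] := natSinv_ltC e0C; exists N => n k Nn Nk.
  apply: le_lt_trans (uC n k) _.
  apply: (@le_lt_trans _ _ ((M + 1) * (n.+1%:R^-1 + k.+1%:R^-1))).
    by rewrite ler_wpM2r ?addr_ge0 ?natSinv_ge0 // lerDl.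
  rewrite mulrC -ltr_pdivlMr ?ltr_wpDl // [ltRHS]splitr.
  by rewrite ltrD ?NP.
have part (f : R[i] -> R) : {morph f : x y / x - y} ->
    (forall z, `|f z|%:C <= `|z|) ->
    exists l : R, forall e : R, 0 < e -> exists N, forall n, (N <= n)%N ->
      `|f (u n) - l| < e.
  move=> fB fle; apply: cauchy_seq_lim => e e0.
  have [N NP] := uC' e e0; exists N => n k Nn Nk.
  by rewrite -fB -ltcR (le_lt_trans (fle _)) // NP.
have [a aP] : exists l : R, forall e : R, 0 < e -> exists N, forall n,
    (N <= n)%N -> `|complex.Re (u n) - l| < e.
  by apply: part => [x y|z]; [rewrite raddfB|exact: normc_ge_Re].
have [b bP] : exists l : R, forall e : R, 0 < e -> exists N, forall n,
    (N <= n)%N -> `|complex.Im (u n) - l| < e.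
  apply: part => [x y|z]; first by rewrite raddfB.
  have := normc_ge_Re ('i%C * z); rewrite normrM (normc_def (0 +i* 1)) /= expr0n expr1n add0r sqrtr1 mul1r.
  by case: z => x y; simpc; rewrite /= normrN.
exists (a +i* b) => n; apply/ler_addgt0Pr => e e0.
have eE : (complex.Re e)%:C = e by rewrite RRe_real // gtr0_real.
have re3 : 0 < complex.Re e / 3 by rewrite divr_gt0 // -ltcR eE.
have [N1 N1P] := aP _ re3; have [N2 N2P] := bP _ re3.
pose k0 := maxn N1 N2.
have [N3 N3P] : exists N3, forall k, (N3 <= k)%N -> M * k.+1%:R^-1 <= e / 3.
  have M1 : 0 < M + 1 by rewrite ltr_wpDl.
  have e3 : 0 < e / 3 / (M + 1) by rewrite !divr_gt0 // ltr0n.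
  have [N NP] := natSinv_ltC e3; exists N => k Nk.
  apply: (@le_trans _ _ ((M + 1) * k.+1%:R^-1)).
    by rewrite ler_wpM2r ?natSinv_ge0 // lerDl.
  by rewrite mulrC -ler_pdivlMr // ltW // NP.
pose k := maxn k0 N3.
rewrite -(subrK (u k) (u n)) -addrA; apply: le_trans (ler_normD _ _) _.
have -> : M / n.+1%:R + e = M / n.+1%:R + e / 3 + (e / 3 + e / 3) by field.
apply: lerD.
  apply: le_trans (uC n k) _; rewrite mulrDr lerD2l N3P //.
  by rewrite leq_maxr.
have -> : u k - (a +i* b) =
    (complex.Re (u k) - a)%:C + 'i%C * (complex.Im (u k) - b)%:C.
  by case: (u k) => x y; simpc.
apply: le_trans (ler_normD _ _) _; rewrite normrM (normc_def (0 +i* 1)) /= expr0n expr1n add0r sqrtr1 mul1r.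
have e3E : e / 3 = (complex.Re e / 3)%:C.
  by rewrite rmorphM /= eE fmorphV /= rmorph_nat.
rewrite e3E !normc_def /= !expr0n /= !addr0 !sqrtr_sqr.
by rewrite lerD // lecR ltW // (N1P, N2P) // !leq_max leqnn ?orbT.
Qed.

Lemma exp_lt1_small (b e : R[i]) : 0 <= b -> b < 1 -> 0 < e ->
  exists N, b ^+ N < e.
Proof.
move=> b0 b1 e0.
have bE : (complex.Re b)%:C = b by rewrite RRe_real // ger0_real.
have eE : (complex.Re e)%:C = e by rewrite RRe_real // gtr0_real.
have rb0 : 0 <= complex.Re b by rewrite -lecR bE.
have nb1 : `|complex.Re b| < 1 by rewrite ger0_norm // -ltcR bE.
have re0 : 0 < complex.Re e by rewrite -ltcR eE.
have /cvgrPdist_lt/(_ _ re0)[N _ /(_ N (leqnn N))] := cvg_geometric 1 nb1.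
rewrite /geometric /= mul1r sub0r normrN ger0_norm ?exprn_ge0 // => h.
by exists N; rewrite -bE -eE -rmorphXn ltcR.
Qed.

(** The discriminant argument behind every Cauchy-Schwarz inequality for a form
    that may be degenerate: p and q are the squared lengths of two vectors x, y
    and b is their inner product, the hypothesis being that x + c y has
    nonnegative squared length. *)
Lemma psd_scalar_cauchy_schwarz p q b : 0 <= p -> 0 <= q ->
  (forall c, 0 <= p + (c * b + c^* * b^*) + `|c| ^+ 2 * q) ->
  `|b| ^+ 2 <= p * q.
Proof.
move=> p0 q0 h; apply/ler_addgt0Pr => e e0.
have p1 : 0 < p + 1 by rewrite ltr_wpDl.
pose d := e / (p + 1); have d0 : 0 < d by rewrite divr_gt0.
have qd0 : 0 < q + d by rewrite ltr_wpDl.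
(* c = - b^* / q is the minimizer; d > 0 keeps the denominator away from 0. *)
pose w := (q + d)^-1; have w0 : 0 < w by rewrite invr_gt0.
have wJ : w^* = w by apply/CrealP; rewrite gtr0_real.
have := h (- (w * b^*)).
rewrite rmorphN rmorphM /= conjCK wJ normrN normrM norm_conjC (gtr0_norm w0).
set B := `|b| ^+ 2; have BE : B = b * b^* by rewrite /B normCK.
have B0 : 0 <= B by rewrite exprn_ge0.
have -> : p + (- (w * b^*) * b + - (w * b) * b^*) + (w * `|b|) ^+ 2 * q
   = p - w * B - w * B * (1 - w * q).
  have -> : (w * `|b|) ^+ 2 = w ^+ 2 * B by rewrite exprMn.
  by rewrite BE; ring.
move=> h'.
have wB : w * B <= p.
  rewrite -subr_ge0; apply: le_trans h' _; rewrite gerBl.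
  rewrite mulr_ge0 ?mulr_ge0 ?(ltW w0) // subr_ge0.
  by rewrite /w mulrC ler_pdivrMr // mul1r lerDl ltW.
apply: (@le_trans _ _ (p * (q + d))).
  by rewrite -ler_pdivrMr // mulrC.
rewrite mulrDr lerD2l /d mulrCA -[leRHS]mulr1 ler_wpM2l ?(ltW e0) //.
by rewrite ler_pdivrMr // mul1r lerDl.
Qed.

End ComplexScalars.

Section RateConvergence.
Variables (R : realType) (V : normedZmodType R[i]).
Implicit Types (u v : nat -> V) (l : V).

Definition rate_cvg u l := exists2 M : R[i], 0 <= M &
  forall n, `|u n - l| <= M * n.+1%:R^-1.

Lemma rate_cvg_cst l : rate_cvg (fun=> l) l.
Proof. by exists 0 => // n; rewrite subrr normr0 mul0r. Qed.

Lemma rate_cvgD u v l k :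
  rate_cvg u l -> rate_cvg v k -> rate_cvg (fun n => u n + v n) (l + k).
Proof.
move=> [M M0 uM] [N N0 vN]; exists (M + N) => [|n]; first exact: addr_ge0.
rewrite opprD addrACA mulrDl; apply: le_trans (ler_normD _ _) _.
exact: lerD.
Qed.

Lemma rate_cvg_sum (I : Type) (s : seq I) (u : I -> nat -> V) (l : I -> V) :
  (forall i, rate_cvg (u i) (l i)) ->
  rate_cvg (fun n => \sum_(i <- s) u i n) (\sum_(i <- s) l i).
Proof.
move=> ul; elim: s => [|i s IHs].
  by exists 0 => // n; rewrite !big_nil subrr normr0 mul0r.
have [M M0 MP] := rate_cvgD (ul i) IHs; exists M => // n.
by rewrite !big_cons.
Qed.

Lemma rate_cvg_unique u l k : rate_cvg u l -> rate_cvg u k -> l = k.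
Proof.
move=> [M M0 uM] [N N0 uN]; apply/eqP; rewrite -subr_eq0 -normr_eq0 eq_le.
rewrite normr_ge0 andbT; apply: (@le_natSinv _ _ _ (M + N)); first exact: addr_ge0.
move=> n; rewrite add0r mulrDl -(subrK (u n) l) -addrA.
by apply: le_trans (ler_normD _ _) _; rewrite lerD // distrC.
Qed.

End RateConvergence.

Section ComplexRateConvergence.
Variable R : realType.
Implicit Types (u v : nat -> R[i]) (l c : R[i]).

Lemma rate_cvgMl u l c : rate_cvg u l -> rate_cvg (fun n => c * u n) (c * l).
Proof.
move=> [M M0 uM]; exists (`|c| * M) => [|n]; first by rewrite mulr_ge0.
by rewrite -mulrBr normrM -mulrA ler_wpM2l.
Qed.

Lemma rate_cvg_conj u l : rate_cvg u l -> rate_cvg (fun n => (u n)^*) l^*.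
Proof.
by move=> [M M0 uM]; exists M => // n; rewrite -rmorphB norm_conjC.
Qed.

Lemma rate_cvg_ge0 u l : (forall n, 0 <= u n) -> rate_cvg u l -> 0 <= l.
Proof.
move=> u0 [M M0 uM].
have lr : l \is Num.real.
  apply/CrealP; apply: (@rate_cvg_unique _ _ u); last by exists M.
  have [N N0 NP] := rate_cvg_conj (ex_intro2 _ _ M M0 uM).
  exists N => // n; have /CrealP {1}<- := ger0_real (u0 n); exact: NP.
apply: (le_natSinv M0) => n; apply: le_trans (u0 n) _.
rewrite -lerBlDl; apply: le_trans (uM n); apply: real_ler_norm.
by rewrite rpredB // ger0_real.
Qed.

End ComplexRateConvergence.

(** * Square roots in a C*-algebra and positive functionals *)

Section SquareRoot.
Variables (R : realType) (A : cstarAlgType R).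
Implicit Types (a b c : A).

Lemma amulNl a b : amul (- a) b = - amul a b.
Proof. by rewrite -scaleN1r amulZl scaleN1r. Qed.

Lemma amulNr a b : amul a (- b) = - amul a b.
Proof. by rewrite -scaleN1r amulZr scaleN1r. Qed.

Lemma starN a : star (- a) = - star a.
Proof. by rewrite -scaleN1r starZ rmorphN rmorph1 scaleN1r. Qed.

Lemma star0 : star 0 = 0 :> A.
Proof. by rewrite -(scale0r (0 : A)) starZ conjC0 !scale0r. Qed.

Lemma norm_star a : `|star a| = `|a|.
Proof.
have le b : `|b| <= `|star b|.
  have [->|b0] := eqVneq b 0; first by rewrite normr0.
  rewrite -(@ler_pM2r _ `|b|) ?normr_gt0 // -expr2 -cstar_id.
  exact: normM_le.
by apply/eqP; rewrite eq_le le -{2}[a]starK le.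
Qed.

(** The equation says 1 - b = (1 - c)^2, written without a unit.  The map
    c |-> (b + c^2)/2 sends the ball of radius |b| to itself and contracts it by
    the factor |b|, so its iterates from 0 converge to a fixed point; they are
    self-adjoint polynomials in b, hence so is their limit. *)
Lemma selfadjoint_sqrt_one_minus b : star b = b -> `|b| < 1 ->
  exists2 c, star c = c & b = c + c - amul c c.
Proof.
move=> bs b1.
pose f c : A := 2^-1 *: (b + amul c c).
have h2 : `|2^-1 : R[i]| = 2^-1 by rewrite ger0_norm // invr_ge0 ler0n.
have b0 : 0 <= `|b| by [].
have f_ball c : `|c| <= `|b| -> `|f c| <= `|b|.
  move=> cb; rewrite normrZ h2 mulrC ler_pdivrMr ?ltr0n // mulr_natr mulr2n.
  apply: le_trans (ler_normD _ _) _; rewrite lerD2l.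
  apply: le_trans (normM_le _ _) _; rewrite -[leRHS]mul1r.
  by rewrite ler_pM // (le_trans cb) // ltW.
have f_contr c d : `|c| <= `|b| -> `|d| <= `|b| ->
    `|f c - f d| <= `|b| * `|c - d|.
  move=> cb db.
  have -> : f c - f d = 2^-1 *: (amul c (c - d) + amul (c - d) d).
    rewrite -scalerBr; congr (_ *: _).
    by rewrite amulDr amulDl amulNr amulNl addrA subrK opprD addrACA subrr add0r.
  rewrite normrZ h2 mulrC ler_pdivrMr ?ltr0n // mulr_natr mulr2n.
  apply: le_trans (ler_normD _ _) _; apply: lerD.
    by apply: le_trans (normM_le _ _) _; rewrite ler_wpM2r.
  by apply: le_trans (normM_le _ _) _; rewrite mulrC ler_wpM2r.
pose u n := iter n f 0.
have u_ball n : `|u n| <= `|b|.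
  by elim: n => [|n IHn]; rewrite ?normr0 //= f_ball.
have u_star n : star (u n) = u n.
  elim: n => [|n IHn]; first exact: star0.
  by rewrite /= /f starZ starD starM bs IHn (CrealP _) // ger0_real // invr_ge0.
(* A contraction moves its iterates by a geometric amount, uniformly in n. *)
have u_cauchy m n : `|u (m + n)%N - u m| <= `|b| ^+ m.
  elim: m => [|m IHm]; first by rewrite subr0 (le_trans (u_ball _)) // ltW.
  rewrite addSn /= exprS; apply: le_trans (f_contr _ _ _ _) _ => //.
  by rewrite ler_wpM2l.
have [l lP] : exists l, forall e : R[i], 0 < e -> exists N, forall n, (N <= n)%N ->
    `|u n - l| < e.
  apply: cauchy_seq_lim => e e0.
  have e2 : 0 < e / 2 by rewrite divr_gt0 // ltr0n.
  have [N NP] := exp_lt1_small b0 b1 e2; exists N => n k Nn Nk.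
  rewrite -(subrK (u N) (u n)) -addrA [ltRHS]splitr.
  apply: le_lt_trans (ler_normD _ _) _; apply: ltrD.
    by rewrite -(subnKC Nn) (le_lt_trans (u_cauchy _ _)).
  by rewrite distrC -(subnKC Nk) (le_lt_trans (u_cauchy _ _)).
have eq_lim (x y : A) (M : R[i]) : 0 <= M ->
    (forall e, 0 < e -> `|x - y| <= M * e) -> x = y.
  move=> M0 h; apply/eqP; rewrite -subr_eq0 -normr_eq0; apply/eqP.
  exact: (le_epsC _ M0).
have l_ball : `|l| <= `|b|.
  apply/ler_addgt0Pr => e e0; have [N /(_ N (leqnn N)) h] := lP e e0.
  rewrite -[l](subrK (u N)) addrC; apply: le_trans (ler_normD _ _) _.
  by rewrite lerD // distrC ltW.
have fl : f l = l.
  apply: (eq_lim _ _ 2) => // e e0; have [N NP] := lP e e0.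
  rewrite -(subrK (u N.+1) (f l)) -addrA mulrDl mul1r.
  apply: le_trans (ler_normD _ _) _; apply: lerD; last by rewrite ltW ?NP.
  apply: le_trans (f_contr _ _ _ _) _ => //; rewrite -[leRHS]mul1r.
  by rewrite ler_pM // ltW // distrC NP.
exists l.
  apply: (eq_lim _ _ 2) => // e e0; have [N /(_ N (leqnn N)) h] := lP e e0.
  rewrite -(subrK (u N) (star l)) -addrA mulrDl mul1r.
  apply: le_trans (ler_normD _ _) _; apply: lerD; last by rewrite ltW.
  by rewrite -{1}(u_star N) -starN -starD norm_star distrC ltW.
have <- : 2 *: f l = l + l by rewrite fl scaler_nat mulr2n.
by rewrite /f scalerA divff ?pnatr_eq0 // scale1r addrK.
Qed.

(** The number m plays the role of the value of g at a unit, and the second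
    hypothesis says that g is nonnegative on (1 - c)* (1 - c).  Since a* a / t^2
    is self-adjoint of norm less than 1, it is 1 - (1 - c)^2 for some
    self-adjoint c, whence g(a* a / t^2) <= m.  This replaces the order
    inequality a* a <= |a|^2, and with it the spectral theory. *)
Lemma positive_functional_bound (g : A -> R[i]) (m : R[i]) :
    (forall k a b, g (k *: a + b) = k * g a + g b) ->
    (forall c, 0 <= m - g c - g (star c) + g (amul (star c) c)) ->
  forall a t, `|a| < t -> g (amul (star a) a) <= t ^+ 2 * m.
Proof.
move=> g_lin g_pos a t at_.
have g0 : g 0 = 0 by have := g_lin (-1) 0 0; rewrite scaler0 addr0 mulN1r addNr.
have gD x y : g (x + y) = g x + g y by rewrite -[x]scale1r g_lin mul1r scale1r.
have gZ k x : g (k *: x) = k * g x by rewrite -[k *: x]addr0 g_lin g0 addr0.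
have gN x : g (- x) = - g x by rewrite -scaleN1r gZ mulN1r.
have t0 : 0 < t by rewrite (le_lt_trans _ at_).
have t20 : 0 < t ^+ 2 by rewrite exprn_gt0.
pose b := (t ^- 2) *: amul (star a) a.
have tJ : (t ^- 2)^* = t ^- 2.
  by apply/CrealP; rewrite ger0_real // invr_ge0 ltW.
have bs : star b = b by rewrite /b starZ starM starK tJ.
have b1 : `|b| < 1.
  rewrite normrZ cstar_id ger0_norm ?invr_ge0 ?ltW // mulrC.
  by rewrite ltr_pdivrMr // mul1r ltr_pXn2r ?nnegrE // ltW.
have [c cs bE] := selfadjoint_sqrt_one_minus bs b1.
have := g_pos c; rewrite cs.
have -> : m - g c - g c + g (amul c c) = m - g b.
  by rewrite bE !gD gN; ring.
by rewrite subr_ge0 /b gZ mulrC ler_pdivrMr // mulrC.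
Qed.

End SquareRoot.

(** * Linear spans, closures and orthogonal projections *)

(** Membership in the closure of W, in the form in which the norm uses it. *)
Definition adherent (R : realType) (V : normedZmodType R[i]) (W : set V) (p : V) :=
  forall e : R[i], 0 < e -> exists2 w, W w & `|p - w| < e.

Section Closure.
Variables (R : realType) (V : normedModType R[i]).
Implicit Types (S W P : set V) (x y v : V).

Lemma sub_lspan S x : S x -> lspan S x.
Proof.
move=> Sx; exists 1, (fun=> 1), (fun=> x); split => //.
by rewrite big_ord1 scale1r.
Qed.

Lemma lspan0 S : lspan S 0.
Proof.
exists 0, (fun=> 0), (fun=> 0); split => [[]//|].
by rewrite big_ord0.
Qed.

Lemma lspan_linear S c x y : lspan S x -> lspan S y -> lspan S (c *: x + y).
Proof.
move=> [n [a [s [sS ->]]]] [m [b [t [tS ->]]]].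
exists (n + m)%N, (fun i => match fintype.split i with inl j => c * a j | inr j => b j end),
  (fun i => match fintype.split i with inl j => s j | inr j => t j end).
split=> [i|]; first by case: fintype.split.
rewrite big_split_ord /= scaler_sumr; congr (_ + _); apply: eq_bigr => i _.
  by rewrite (unsplitK (inl i)) scalerA.
by rewrite (unsplitK (inr i)).
Qed.

Lemma lspan_min S P : P 0 -> (forall c x y, P x -> P y -> P (c *: x + y)) ->
  S `<=` P -> lspan S `<=` P.
Proof.
move=> P0 PP SP _ [n [c [s [sS ->]]]].
apply: (big_ind P) => // [x y Px Py|i _].
  by rewrite -[x]scale1r; exact: PP.
by rewrite -[_ *: _]addr0; apply: PP => //; apply: SP.
Qed.

Lemma sub_adherent W x : W x -> adherent W x.
Proof. by move=> Wx e e0; exists x => //; rewrite subrr normr0. Qed.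

Lemma adherent_trans W P x : W `<=` adherent P -> adherent W x -> adherent P x.
Proof.
move=> WP Wx e e0; have e2 : 0 < e / 2 by rewrite divr_gt0 // ltr0n.
have [w /WP/(_ _ e2)[p Pp wp] xw] := Wx _ e2; exists p => //.
by rewrite -(subrKA w) [e]splitr (le_lt_trans (ler_normD _ _)) // ltrD.
Qed.

Lemma adherent_linear W c x y :
    (forall c x y, W x -> W y -> W (c *: x + y)) ->
  adherent W x -> adherent W y -> adherent W (c *: x + y).
Proof.
move=> WP Wx Wy e e0; have e2 : 0 < e / 2 by rewrite divr_gt0 // ltr0n.
have c1 : 0 < `|c| + 1 by rewrite ltr_wpDl.
have [w Ww xw] := Wx _ (divr_gt0 e2 c1); have [z Wz yz] := Wy _ e2.
exists (c *: w + z); first exact: WP.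
rewrite opprD addrACA -scalerBr [e]splitr (le_lt_trans (ler_normD _ _)) //.
apply: ler_ltD => //; rewrite normrZ.
apply: (@le_trans _ _ ((`|c| + 1) * `|x - w|)).
  by rewrite ler_wpM2r // lerDl.
by rewrite mulrC -ler_pdivlMr // ltW.
Qed.

End Closure.

Lemma denseP (R : realType) (V : normedModType R[i]) (S : set V) :
  dense S <-> forall x (e : R[i]), 0 < e -> exists2 d, S d & `|x - d| < e.
Proof.
split=> [dS x e e0|h O [x Ox] oO].
  have [||d [xd Sd]] := dS (ball x e).
  - by exists x; exact: ballxx.
  - exact: ball_open.
  by exists d => //; move: xd; rewrite -ball_normE.
have /nbhs_ballP[e /= e0 xe] : nbhs x O by exact: open_nbhs_nbhs.
have [d Sd xd] := h x e e0; exists d; split => //.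
by apply: xe; rewrite -ball_normE.
Qed.

Section Projection.
Variables (R : realType) (H : hilbertType R) (W : set H).
Implicit Types (h p q w : H).

Lemma orthogonal_adherent p q :
  adherent W p -> (forall w, W w -> hdot w q = 0) -> hdot p q = 0.
Proof.
move=> pW qW; apply/eqP; rewrite -normr_eq0; apply/eqP.
apply: (@le_epsC _ _ `|q|) => // e e0.
have [w Ww pw] := pW e e0.
rewrite -(subrK w p) hdotDl (qW w) // addr0 mulrC.
by apply: le_trans (cauchy_schwarz _ _) _; rewrite ler_wpM2r // ltW.
Qed.

Hypothesis W0 : W 0.
Hypothesis WP : forall k x y, W x -> W y -> W (k *: x + y).

(** The projection is the limit of a minimizing sequence for the distance from
    h to W, which is Cauchy by the parallelogram law; near-minimality makes the
    terms of the sequence nearly orthogonal to W.  It lies in the closure of W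
    only, as W need not be closed. *)
Lemma orthogonal_projection h :
  exists2 p, adherent W p & forall w, W w -> hdot w (h - p) = 0.
Proof.
pose E : set R := [set complex.Re (`|h - w| ^+ 2) | w in W].
have ReE w : (complex.Re (`|h - w| ^+ 2))%:C = `|h - w| ^+ 2.
  by rewrite RRe_real // ger0_real // exprn_ge0.
have E_lb : lbound E 0.
  by move=> _ [w _ <-]; rewrite -lecR ReE exprn_ge0.
pose d : R[i] := (inf E)%:C.
have d_le w : W w -> d <= `|h - w| ^+ 2.
  by move=> Ww; rewrite -ReE lecR; apply: ge_inf; [exists 0|exists w].
have d_lt n : exists w, W w /\ `|h - w| ^+ 2 < d + n.+1%:R^-1.
  have hE : has_inf E by split; [exists (complex.Re (`|h - 0| ^+ 2)), 0|exists 0].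
  have e0 : (0 : R) < n.+1%:R^-1 by rewrite invr_gt0 ltr0n.
  have [_ [u Ku <-] lt] := inf_adherent e0 hE.
  exists u; split => //.
  by rewrite -ReE -(rmorph_nat (real_complex R)) -fmorphV /= -rmorphD ltcR.
have [u uP] := choice d_lt.
have Wu n : W (u n) by case: (uP n).
have du n : `|h - u n| ^+ 2 < d + n.+1%:R^-1 by case: (uP n).
have u_close n k : `|u n - u k| ^+ 2 < (n.+1%:R^-1 + k.+1%:R^-1) *+ 2.
  (* The midpoint of u n and u k lies in W, at distance at least sqrt d of h. *)
  have dm4 : d *+ 4 <= `|(h - u n) + (h - u k)| ^+ 2.
    have -> : (h - u n) + (h - u k) = 2 *: (h - 2^-1 *: (u n + u k)).
      rewrite scalerBr scalerA divff ?pnatr_eq0 // scale1r scaler_nat mulr2n.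
      by rewrite addrACA opprD.
    rewrite normrZ exprMn ger0_norm ?ler0n // -natrX mulr_natl.
    rewrite lerMn2r /= d_le // -[_ *: _]addr0; apply: (WP _ _ W0).
    by rewrite -[u n]scale1r; exact: WP.
  have -> : u n - u k = - ((h - u n) - (h - u k)).
    by rewrite !opprB [RHS]addrC addrA subrK.
  rewrite normrN; have := parallelogram (h - u n) (h - u k).
  move=> /(canRL (addKr _)) ->; rewrite addrC ltrBlDr.
  apply: (@lt_le_trans _ _ ((d + n.+1%:R^-1 + (d + k.+1%:R^-1)) *+ 2)).
    by rewrite ltrMn2r /= ltrD.
  have -> : (d + n.+1%:R^-1 + (d + k.+1%:R^-1)) *+ 2 =
     (n.+1%:R^-1 + k.+1%:R^-1) *+ 2 + d *+ 4 by ring.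
  by rewrite lerD2l.
have [p pP] : exists l, forall e : R[i], 0 < e -> exists N, forall n, (N <= n)%N ->
    `|u n - l| < e.
  apply: cauchy_seq_lim => e e0.
  have e4 : 0 < e ^+ 2 / 4 by rewrite divr_gt0 ?exprn_gt0 ?ltr0n.
  have [N NP] := natSinv_ltC e4; exists N => n k Nn Nk.
  rewrite -(@ltr_pXn2r _ 2) ?nnegrE ?(ltW e0) //; apply: lt_trans (u_close n k) _.
  have -> : e ^+ 2 = (e ^+ 2 / 4 + e ^+ 2 / 4) *+ 2 by field.
  by rewrite ltrMn2r /= ltrD ?NP.
exists p => [e e0|w Ww].
  by have [N /(_ N (leqnn N))] := pP e e0; exists (u N) => //; rewrite distrC.
have ortho n : `|hdot (h - u n) w| ^+ 2 <= n.+1%:R^-1 * `|w| ^+ 2.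
  apply: (@le_trans _ _ ((`|h - u n| ^+ 2 - d) * `|w| ^+ 2)); last first.
    by rewrite ler_wpM2r ?exprn_ge0 // lerBlDl ltW.
  apply: psd_scalar_cauchy_schwarz; rewrite ?exprn_ge0 ?subr_ge0 ?d_le // => c.
  have := d_le _ (WP (- c) Ww (Wu n)).
  have -> : h - (- c *: w + u n) = (h - u n) + c *: w.
    by rewrite scaleNr opprD opprK addrA addrAC.
  rewrite -subr_ge0.
  rewrite normD2 normrZ hdotZr hdotZl exprMn [hdot w _]hdotC.
  by congr (_ <= _); ring.
apply/eqP; rewrite -normr_eq0; apply/eqP.
apply: (@le_epsC _ _ (`|w| *+ 2)) => [||e e0]; rewrite ?mulrn_wge0 //.
have [N NP] := pP e e0; have [N' NP'] := natSinv_ltC (exprn_gt0 2 e0).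
pose n := maxn N N'.
rewrite -(subrK (u n) h) -addrA hdotDr; apply: le_trans (ler_normD _ _) _.
rewrite mulrnAl mulr2n lerD //; last first.
  apply: le_trans (cauchy_schwarz _ _) _.
  by rewrite ler_wpM2l // ltW // NP // leq_maxl.
rewrite -(@ler_pXn2r _ 2) ?nnegrE ?mulr_ge0 ?(ltW e0) // exprMn.
rewrite hdotC norm_conjC; apply: le_trans (ortho n) _.
by rewrite mulrC ler_wpM2l ?exprn_ge0 // ltW // NP' // leq_maxr.
Qed.

End Projection.

(** * Representations of a C*-algebra *)

Section Representation.
Variables (R : realType) (A : cstarAlgType R) (H : hilbertType R).
Variables (rho : A -> 'L(H)) (rho_hom : star_hom rho).
Implicit Types (a b : A) (x y h : H).

Lemma rep_adjoint a x y : hdot (rho a x) y = hdot x (rho (star a) y).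
Proof. by case: rho_hom => _ _ ->; rewrite boundedOp_starE -adjointE. Qed.

Lemma rep_mul a b x : rho (amul a b) x = rho a (rho b x).
Proof. by case: rho_hom => _ ->. Qed.

Lemma rep_linear k a b x : rho (k *: a + b) x = k *: rho a x + rho b x.
Proof. by case: rho_hom => ->. Qed.

Lemma rep0 x : rho 0 x = 0.
Proof.
have := rep_linear (-1) 0 0 x.
by rewrite scaler0 addr0 scaleN1r addNr.
Qed.

Lemma rep_bound a t h : `|a| < t -> `|rho a h| <= t * `|h|.
Proof.
move=> at_; have t0 : 0 <= t by rewrite (le_trans _ (ltW at_)).
rewrite -(@ler_pXn2r _ 2) ?nnegrE ?mulr_ge0 // exprMn.
have := @positive_functional_bound _ _ (fun b => hdot h (rho b h)) (`|h| ^+ 2).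
rewrite -(hdot_norm (rho a h)) rep_adjoint -rep_mul; apply => // [k b c|c].
  by rewrite rep_linear hdotDr hdotZr.
have : 0 <= `|h - rho c h| ^+ 2 by rewrite exprn_ge0.
rewrite normB2 -(hdot_norm (rho c h)) !rep_adjoint -rep_mul.
by congr (_ <= _); ring.
Qed.

(** Automatic continuity of representations. *)
Lemma rep_contractive a h : `|rho a h| <= `|a| * `|h|.
Proof.
apply/ler_addgt0Pr => e e0; have h1 : 0 < `|h| + 1 by rewrite ltr_wpDl.
have d0 : 0 < e / (`|h| + 1) by rewrite divr_gt0.
apply: le_trans (@rep_bound a (`|a| + e / (`|h| + 1)) h _) _; first by rewrite ltrDl.
rewrite mulrDl lerD2l mulrAC -mulrA -[leRHS]mulr1 ler_wpM2l ?(ltW e0) //.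
by rewrite ler_pdivrMr // mul1r lerDl.
Qed.

Hypothesis rho_nondeg : acts_nondegenerately rho.

Let cyclic h : set H := [set rho b h | b in setT].

Let cyclic0 h : cyclic h 0. Proof. by exists 0 => //; exact: rep0. Qed.

Let cyclicP h k x y : cyclic h x -> cyclic h y -> cyclic h (k *: x + y).
Proof. by move=> [b _ <-] [c _ <-]; exists (k *: b + c) => //; exact: rep_linear. Qed.

(** A vector killed by rho(A) is orthogonal to rho(A) H, which is dense. *)
Lemma nondegenerate_annihilator q : (forall b, rho b q = 0) -> q = 0.
Proof.
move=> q0; apply/eqP; rewrite -normr_eq0 -sqrf_eq0 -hdot_norm.
apply/eqP; apply: (@orthogonal_adherent _ _ (lspan [set v | exists a x, v = rho a x])).
  by move=> e e0; have /denseP/(_ q e e0) := rho_nondeg.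
move=> _ [n [c [s [sP ->]]]].
apply: (big_ind (fun v => hdot v q = 0)) => [|x y x0 y0|i _].
- exact: hdot0l.
- by rewrite hdotDl x0 y0 addr0.
have [a [x ->]] := sP i.
by rewrite hdotZl rep_adjoint q0 hdot0r mulr0.
Qed.

(** P is the orthogonal projection on the closure of rho(A) k.  It fixes k: both
    that closure and its orthogonal complement are invariant under rho, so
    q = k - P k satisfies rho(b) q = 0 for all b and vanishes by nondegeneracy. *)
Lemma cyclic_decomposition k : exists P : H -> H,
  [/\ forall h, adherent (cyclic k) (P h),
      forall h b, hdot (rho b k) (h - P h) = 0 & P k = k].
Proof.
have /choice[P PP] : forall h, exists p, adherent (cyclic k) p /\
    forall b, hdot (rho b k) (h - p) = 0.
  move=> h; have [p p1 p2] := orthogonal_projection (cyclic0 k) (@cyclicP k) h.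
  by exists p; split=> // b; apply: p2; exists b.
exists P; split=> [h|h b|]; try by case: (PP h).
have [Pk kP] := PP k; apply/esym/eqP; rewrite -subr_eq0; apply/eqP.
apply: nondegenerate_annihilator => b.
(* The component of k off the cyclic subspace stays orthogonal to it. *)
have orth c : hdot (rho c k) (rho b (k - P k)) = 0.
  by rewrite -[b]starK -rep_adjoint -rep_mul kP.
apply/eqP; rewrite -normr_eq0 -sqrf_eq0 -hdot_norm.
rewrite {1}linearB hdotBl orth sub0r oppr_eq0 rep_adjoint.
apply/eqP; apply: orthogonal_adherent Pk _ => _ [c _ <-].
by rewrite -rep_adjoint -rep_mul orth.
Qed.

End Representation.

(** * Positivity of the interior inner product *)

Section GramPositivity.
Variables (R : realType) (B : cstarAlgType R) (X : hilbertModType B).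
Variables (H : hilbertType R) (rho : B -> 'L(H)).
Hypotheses (rho_hom : star_hom rho) (rho_nondeg : acts_nondegenerately rho).

(** The inner product of the elementary tensors u.1 (x) u.2 and v.1 (x) v.2. *)
Definition interior_form (u v : X * H) : R[i] :=
  hdot u.2 (rho (bdot u.1 v.1) v.2).

Let gram (l : seq (X * H)) : R[i] :=
  \sum_(u <- l) \sum_(v <- l) interior_form u v.

(** When all the vectors lie in one cyclic subspace rho(B) k, the elements of B
    can be moved to the X side, and the double sum collapses to
    <k, rho(<z, z>) k> for a single z in X. *)
Lemma interior_form_cyclic_ge0 (k : H) (c : H -> B) (l : seq (X * H)) :
  0 <= \sum_(u <- l) \sum_(v <- l) interior_form (u.1, rho (c u.2) k) (v.1, rho (c v.2) k).
Proof.
pose z := \sum_(u <- l) ract u.1 (c u.2).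
suff -> : \sum_(u <- l) \sum_(v <- l) interior_form (u.1, rho (c u.2) k) (v.1, rho (c v.2) k)
   = hdot k (rho (bdot z z) k).
  have [d ->] := bdot_ge0 z.
  by rewrite rep_mul // -rep_adjoint // hdot_norm exprn_ge0.
have linr x : hdot k (rho (bdot x z) k) =
    \sum_(v <- l) hdot k (rho (bdot x (ract v.1 (c v.2))) k).
  rewrite /z; apply: (big_morph (fun y => hdot k (rho (bdot x y) k))) => [y y'|].
    by rewrite bdotDr -[bdot x y]scale1r rep_linear // !scale1r hdotDr.
  by rewrite -(scale0r (0 : X)) bdotZr scale0r rep0 // hdot0r.
rewrite {1}/z (big_morph (fun y => hdot k (rho (bdot y z) k))
  (id1 := 0) (op1 := +%R)) => [|y y'|].
- apply: eq_bigr => u _; rewrite linr; apply: eq_bigr => v _.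
  rewrite /interior_form /= rep_adjoint // -!rep_mul //.
  by rewrite bdot_ract [bdot (ract _ _) _]bdotC bdot_ract starM -bdotC.
- by rewrite bdotDl -[bdot y z]scale1r rep_linear // !scale1r hdotDr.
- by rewrite -(scale0r (0 : X)) bdotZl rmorph0 scale0r rep0 // hdot0r.
Qed.

Lemma interior_form_rate_cvg (x y : X) (p q : nat -> H) (p' q' : H) :
  rate_cvg p p' -> rate_cvg q q' ->
  rate_cvg (fun n => interior_form (x, p n) (y, q n)) (interior_form (x, p') (y, q')).
Proof.
move=> [M M0 pM] [N N0 qN]; rewrite /interior_form /=.
set T := rho _; have [K K0 TK] := boundedOp_bound_ge0 T.
exists (M * (K * (N + `|q'|)) + `|p'| * (K * N)) => [|n].
  by rewrite !(addr_ge0, mulr_ge0).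
have -> : hdot (p n) (T (q n)) - hdot p' (T q') =
    hdot (p n - p') (T (q n)) + hdot p' (T (q n - q')).
  by rewrite hdotBl linearB hdotBr addrA subrK.
have n1 : n.+1%:R^-1 <= 1 :> R[i] by rewrite invf_le1 ?ler1n ?ltr0n.
have qn : `|q n| <= N + `|q'|.
  rewrite -{1}(subrK q' (q n)); apply: le_trans (ler_normD _ _) _.
  rewrite lerD2r; apply: le_trans (qN n) _.
  by rewrite -[leRHS]mulr1 ler_wpM2l.
apply: le_trans (ler_normD _ _) _; rewrite mulrDl; apply: lerD.
  apply: le_trans (cauchy_schwarz _ _) _.
  rewrite [leRHS]mulrAC; apply: ler_pM => //.
  by apply: le_trans (TK _) _; rewrite ler_wpM2l.
apply: le_trans (cauchy_schwarz _ _) _.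
rewrite -!mulrA ler_wpM2l //; apply: le_trans (TK _) _.
by rewrite ler_wpM2l.
Qed.

(** Induction on the number of tensors.  The vector k of the first one generates
    a cyclic subspace; projecting all the vectors on its closure leaves a limit
    of sums covered by the previous case, and what remains involves one tensor
    less because k is its own projection. *)
Lemma interior_form_gram_ge0 (l : seq (X * H)) : 0 <= gram l.
Proof.
have [n] := ubnP (size l); elim: n l => // n IHn [|[x k] l] /=.
  by rewrite /gram big_nil.
rewrite ltnS => ln.
have [P [P_adh P_orth Pk]] := cyclic_decomposition rho_hom rho_nondeg k.
set L := (x, k) :: l.
pose proj (u : X * H) := (u.1, P u.2); pose rest (u : X * H) := (u.1, u.2 - P u.2).
(* rho leaves the orthogonal complement of rho(B) k invariant. *)
have cross u v : interior_form (proj u) (rest v) = 0.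
  apply: orthogonal_adherent (P_adh _) _ => _ [b _ <-].
  by rewrite -[bdot _ _]starK -rep_adjoint // -rep_mul // P_orth.
have split u v : interior_form u v =
    interior_form (proj u) (proj v) + interior_form (rest u) (rest v).
  have := cross u v; have := cross v u; rewrite /interior_form /=.
  rewrite [hdot (P v.2) _]hdotC [hdot _ (P _)]rep_adjoint // -bdotC => /eqP.
  rewrite conjC_eq0 => /eqP vu uv.
  rewrite -{1}(subrKC (P u.2) u.2) -{1}(subrKC (P v.2) v.2).
  set a := u.2 - P u.2 in vu *; set b := v.2 - P v.2 in uv *.
  by rewrite linearD hdotDl !hdotDr uv vu addr0 add0r.
have -> : gram L = \sum_(u <- L) \sum_(v <- L) interior_form (proj u) (proj v)
    + gram (map rest l).
  rewrite /gram; under eq_bigr do under eq_bigr do rewrite split.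
  under eq_bigr do rewrite big_split /=.
  rewrite big_split /=; congr (_ + _).
  have rl v : interior_form (rest (x, k)) v = 0.
    by rewrite /interior_form /= Pk subrr hdot0l.
  have rr u : interior_form u (rest (x, k)) = 0.
    by rewrite /interior_form /= Pk subrr linear0 hdot0r.
  rewrite /L big_cons [X in X + _]big1 => [|? _]; last exact: rl.
  rewrite add0r big_map; apply: eq_bigr => u _.
  by rewrite big_cons rr add0r big_map.
apply: addr_ge0; last by apply: IHn; rewrite size_map.
have /choice[c cP] : forall hn : H * nat, exists b,
    `|P hn.1 - rho b k| < hn.2.+1%:R^-1.
  move=> [h m] /=.
  have e0 : 0 < m.+1%:R^-1 :> R[i] by rewrite invr_gt0 ltr0n.
  by have [_ [b _ <-] ?] := P_adh h _ e0; exists b.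
have cvgP h : rate_cvg (fun m => rho (c (h, m)) k) (P h).
  by exists 1 => // m; rewrite mul1r distrC ltW // (cP (h, m)).
apply: (@rate_cvg_ge0 _ (fun m => \sum_(u <- L) \sum_(v <- L)
    interior_form (u.1, rho (c (u.2, m)) k) (v.1, rho (c (v.2, m)) k))).
  by move=> m; exact: (interior_form_cyclic_ge0 k (fun h => c (h, m))).
apply: rate_cvg_sum => u; apply: rate_cvg_sum => v.
exact: interior_form_rate_cvg.
Qed.

End GramPositivity.

(** * The Hilbert space of a positive definite kernel *)

Section Kernel.
Variables (R : realType) (G : Type).

(** A list of pairs (c, g) stands for the formal combination of the symbols g
    with coefficients c. *)
Record pd_kernel := PdKernel {
  kernel :> G -> G -> R[i];
  kernel_herm : forall g h, kernel h g = (kernel g h)^*;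
  kernel_ge0 : forall l : seq (R[i] * G),
    0 <= \sum_(p <- l) \sum_(q <- l) p.1^* * q.1 * kernel p.2 q.2
}.

Variable K : pd_kernel.
Implicit Types (F : G -> R[i]^o) (l m : seq (R[i] * G)) (c e M : R[i]).

Definition lcomb c l m := [seq (c * p.1, p.2) | p <- l] ++ m.

(** The inner product of the formal combination m with the vector that F
    represents, F being understood as g |-> <g, F>. *)
Definition pairing F m : R[i] := \sum_(p <- m) p.1^* * F p.2.

(** The function that represents the formal combination l. *)
Definition span_fun l : G -> R[i]^o := fun g => \sum_(q <- l) q.1 * K g q.2.

Definition gram m l := pairing (span_fun l) m.

Definition lnorm l := sqrtC (gram l l).

Lemma pairing_lcomb F c l m :
  pairing F (lcomb c l m) = c^* * pairing F l + pairing F m.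
Proof.
rewrite /pairing big_cat big_map mulr_sumr /=; congr (_ + _).
by apply: eq_bigr => p _; rewrite rmorphM /= mulrA.
Qed.

Lemma pairing_linear c F F' m :
  pairing (c *: F + F') m = c * pairing F m + pairing F' m.
Proof.
rewrite /pairing mulr_sumr -big_split /=; apply: eq_bigr => p _.
by rewrite mulrDr mulrCA.
Qed.

Lemma pairing1 F g : pairing F [:: (1, g)] = F g.
Proof. by rewrite /pairing big_seq1 conjC1 mul1r. Qed.

Lemma gram_lcombr m c l l' :
  gram m (lcomb c l l') = c * gram m l + gram m l'.
Proof.
rewrite -pairing_linear; congr pairing; apply/funext => g.
rewrite /span_fun big_cat big_map /=; congr (_ + _).
rewrite [RHS](_ : _ = c * (\sum_(q <- l) q.1 * K g q.2)) // mulr_sumr.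
by apply: eq_bigr => q _; rewrite mulrA.
Qed.

Lemma gramC l m : gram m l = (gram l m)^*.
Proof.
rewrite /gram /pairing /span_fun rmorph_sum /=.
under [LHS]eq_bigr do rewrite mulr_sumr.
rewrite exchange_big; apply: eq_bigr => q _ /=.
rewrite rmorphM rmorph_sum /= conjCK mulr_sumr; apply: eq_bigr => p _.
by rewrite rmorphM /= -kernel_herm mulrCA.
Qed.

Lemma gram_lcombl m c l l' :
  gram (lcomb c l l') m = c^* * gram l m + gram l' m.
Proof. exact: pairing_lcomb. Qed.

Lemma gram_ge0 l : 0 <= gram l l.
Proof.
have := kernel_ge0 K l; rewrite /gram /pairing /span_fun.
under eq_bigr do under eq_bigr do rewrite -mulrA.
by under eq_bigr do rewrite -mulr_sumr.
Qed.

Lemma lnorm_ge0 l : 0 <= lnorm l.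
Proof. by rewrite sqrtC_ge0 gram_ge0. Qed.

Lemma lnorm_sqr l : lnorm l ^+ 2 = gram l l.
Proof. exact: sqrtCK. Qed.

Lemma gram_cauchy_schwarz l m : `|gram l m| <= lnorm l * lnorm m.
Proof.
rewrite -(@ler_pXn2r _ 2) ?nnegrE ?mulr_ge0 ?lnorm_ge0 // exprMn !lnorm_sqr.
apply: psd_scalar_cauchy_schwarz; rewrite ?gram_ge0 // => c.
have := gram_ge0 (lcomb c m l).
rewrite gram_lcombl !gram_lcombr [gram m l]gramC normCK.
by congr (_ <= _); ring.
Qed.

Lemma lnorm_le l e : 0 <= e -> gram l l <= e * lnorm l -> lnorm l <= e.
Proof.
move=> e0 h; have [->//|l0] := eqVneq (lnorm l) 0.
have lp : 0 < lnorm l by rewrite lt_def l0 lnorm_ge0.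
by rewrite -(ler_pM2r lp) -expr2 lnorm_sqr.
Qed.

(** F, as a functional on formal combinations, has norm at most M. *)
Definition dual_le F M := forall m, `|pairing F m| <= M * lnorm m.

Definition approximates F l e := dual_le (F - span_fun l) e.

Lemma pairingB F F' m : pairing (F - F') m = pairing F m - pairing F' m.
Proof. by rewrite addrC -scaleN1r pairing_linear mulN1r addrC. Qed.

Lemma approxE F l e m : approximates F l e ->
  `|pairing F m - gram m l| <= e * lnorm m.
Proof. by move=> /(_ m); rewrite pairingB. Qed.

(** The closure in the dual norm of the functions of formal combinations.  This
    gives the completion without a quotient, since a function determines the
    vector that it represents. *)
Definition rkhs_pred : {pred (G -> R[i]^o)} :=
  mem [set F : G -> R[i]^o | forall e, 0 < e -> exists l, approximates F l e].

Lemma rkhs_predP F :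
  reflect (forall e, 0 < e -> exists l, approximates F l e) (F \in rkhs_pred).
Proof. by apply: (iffP idP); rewrite inE. Qed.

Lemma approximates_lcomb c F F' l l' e e' :
  approximates F l e -> approximates F' l' e' ->
  approximates (c *: F + F') (lcomb c l l') (`|c| * e + e').
Proof.
move=> Fl Fl' m; rewrite pairingB -/(gram _ _) pairing_linear gram_lcombr.
rewrite opprD addrACA -mulrBr mulrDl; apply: le_trans (ler_normD _ _) _.
by rewrite normrM -mulrA lerD ?ler_wpM2l ?approxE.
Qed.

Lemma approximates_span l : approximates (span_fun l) l 0.
Proof. by move=> m; rewrite pairingB subrr normr0 mul0r. Qed.

Lemma approximates_le F l e e' : e <= e' -> approximates F l e -> approximates F l e'.
Proof.
by move=> ee' Fl m; apply: le_trans (Fl m) _; rewrite ler_wpM2r ?lnorm_ge0.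
Qed.

Lemma rkhs_submod_closed : submod_closed rkhs_pred.
Proof.
split.
  apply/rkhs_predP => e e0; exists [::].
  have -> : 0 = span_fun [::] :> (G -> R[i]^o).
    by apply/funext => g; rewrite /span_fun big_nil.
  exact: approximates_le (ltW e0) (@approximates_span _).
move=> c F F' /rkhs_predP FP /rkhs_predP FP'; apply/rkhs_predP => e e0.
have c1 : 0 < `|c| + 1 by rewrite ltr_wpDl.
have e2 : 0 < e / 2 by rewrite divr_gt0 // ltr0n.
have [l lP] := FP (e / 2 / (`|c| + 1)) (divr_gt0 e2 c1); have [l' lP'] := FP' _ e2.
exists (lcomb c l l'); apply: approximates_le (approximates_lcomb c lP lP').
rewrite [leRHS]splitr lerD2r mulrCA -[leRHS]mulr1 ler_wpM2l ?(ltW e2) //.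
by rewrite ler_pdivrMr // mul1r lerDl.
Qed.

Record rkhs := Rkhs { rkhs_fun :> G -> R[i]^o; rkhs_subproof : rkhs_fun \in rkhs_pred }.

HB.instance Definition _ := [isSub for rkhs_fun].
HB.instance Definition _ := [Choice of rkhs by <:].
HB.instance Definition _ :=
  GRing.isSubmodClosed.Build _ _ rkhs_pred rkhs_submod_closed.
HB.instance Definition _ := [SubChoice_isSubLmodule of rkhs by <:].

End Kernel.

Section RkhsHilbert.
Variables (R : realType) (G : Type) (K : pd_kernel R G).
Local Notation H := (rkhs K).
Implicit Types (F : H) (l m : seq (R[i] * G)) (c e M : R[i]).

Lemma rkhs_eqP F F' : F =1 F' -> F = F'.
Proof. by move=> /funext FF'; apply: val_inj. Qed.

Lemma approximates_ex F e : 0 < e -> exists l, approximates K F l e.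
Proof. by move=> e0; have /rkhs_predP := rkhs_subproof F; exact. Qed.

Lemma natSinv_gt0 n : 0 < n.+1%:R^-1 :> R[i].
Proof. by rewrite invr_gt0 ltr0n. Qed.

Definition approximant F n := projT1 (cid (approximates_ex F (natSinv_gt0 n))).

Lemma approximantP F n : approximates K F (approximant F n) n.+1%:R^-1.
Proof. exact: (projT2 (cid (approximates_ex F (natSinv_gt0 n)))). Qed.

Lemma dual_bounded F : exists2 M, 0 <= M & dual_le K F M.
Proof.
have [l lP] := approximates_ex F ltr01; exists (1 + lnorm K l) => [|m].
  by rewrite addr_ge0 ?lnorm_ge0.
rewrite -(subrK (gram K m l) (pairing F m)) mulrDl.
apply: le_trans (ler_normD _ _) _; apply: lerD; first exact: approxE.
by rewrite mulrC gram_cauchy_schwarz.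
Qed.

Lemma approx_lnorm F l M e : 0 <= M -> 0 <= e ->
  dual_le K F M -> approximates K F l e -> lnorm K l <= M + e.
Proof.
move=> M0 e0 FM Fl; apply: lnorm_le; first exact: addr_ge0.
rewrite -[leLHS]ger0_norm ?gram_ge0 // -(subrKC (pairing F l) (gram K l l)).
rewrite mulrDl; apply: le_trans (ler_normD _ _) _.
by rewrite lerD // distrC; exact: approxE.
Qed.

(** Two formal combinations that approximate the same F differ, in the seminorm
    of the kernel, by at most the sum of the errors; hence so do the values on
    them of a bounded functional. *)
Lemma approx_dist F l l' e e' M (F' : H) : 0 <= M -> 0 <= e + e' ->
  dual_le K F' M -> approximates K F l e -> approximates K F l' e' ->
  `|pairing F' l - pairing F' l'| <= M * (e + e').
Proof.
move=> M0 ee0 FM Fl Fl'; set d := lcomb (-1) l' l.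
have -> : pairing F' l - pairing F' l' = pairing F' d.
  by rewrite pairing_lcomb rmorphN rmorph1 mulN1r addrC.
apply: le_trans (FM d) _; rewrite ler_wpM2l //; apply: lnorm_le => //.
rewrite -[leLHS]ger0_norm ?gram_ge0 // {2}/d gram_lcombr mulN1r addrC.
rewrite -(subrKA (pairing F d)) mulrDl; apply: le_trans (ler_normD _ _) _.
by rewrite lerD //; [rewrite distrC|]; exact: approxE.
Qed.

Lemma dot_ex F (F' : H) :
  exists z : R[i], rate_cvg (fun n => pairing F' (approximant F n)) z.
Proof.
have [M M0 FM] := dual_bounded F'.
have [|z zP] := @cauchy_seq_limC _ (fun n => pairing F' (approximant F n)) _ M0.
  move=> n k; apply: (approx_dist M0 _ FM); try exact: approximantP.
  by rewrite addr_ge0 ?natSinv_ge0.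
by exists z; exists M.
Qed.

(** F is approximated by formal combinations, and on these the inner product with
    F' is dictated by the pairing. *)
Definition rkhs_dot F (F' : H) : R[i] := projT1 (cid (dot_ex F F')).

Lemma pairing_rate_cvg F (F' : H) (l : nat -> seq (R[i] * G)) :
  (forall n, approximates K F (l n) n.+1%:R^-1) ->
  rate_cvg (fun n => pairing F' (l n)) (rkhs_dot F F').
Proof.
move=> Fl; have [N N0 NP] := projT2 (cid (dot_ex F F')).
have [M M0 FM] := dual_bounded F'.
exists (M * 2 + N) => [|n]; first by rewrite addr_ge0 ?mulr_ge0.
rewrite -(subrKA (pairing F' (approximant F n))) mulrDl.
apply: le_trans (ler_normD _ _) _; apply: lerD (NP n).
rewrite -mulrA mulr_natl mulr2n; apply: (approx_dist M0 _ FM (Fl n)).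
  by rewrite addr_ge0 ?natSinv_ge0.
exact: approximantP.
Qed.

Lemma rkhs_dot_linear F c (F1 F2 : H) :
  rkhs_dot F (c *: F1 + F2) = c * rkhs_dot F F1 + rkhs_dot F F2.
Proof.
have h F' := pairing_rate_cvg F' (approximantP F).
apply: rate_cvg_unique (h _) _.
rewrite [X in rate_cvg X](_ : _ = fun n => c * pairing F1 (approximant F n) +
    pairing F2 (approximant F n)); first exact: rate_cvgD (rate_cvgMl c (h _)) (h _).
by apply/funext => n; rewrite -pairing_linear.
Qed.

(** The inner product is the limit of those of the approximants of both vectors,
    a symmetric description from which hermitian symmetry and positivity follow. *)
Lemma gram_rate_cvg F (F' : H) :
  rate_cvg (fun n => gram K (approximant F n) (approximant F' n)) (rkhs_dot F F').
Proof.
have [N N0 NP] := pairing_rate_cvg F' (approximantP F).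
have [M M0 FM] := dual_bounded F.
exists (M + 1 + N) => [|n]; first by rewrite !addr_ge0.
rewrite -(subrKA (pairing F' (approximant F n))) mulrDl.
apply: le_trans (ler_normD _ _) _; apply: lerD (NP n).
rewrite distrC; apply: le_trans (approxE _ (approximantP F' n)) _.
rewrite mulrC ler_wpM2r ?natSinv_ge0 //.
apply: le_trans (approx_lnorm M0 (natSinv_ge0 _ _) FM (approximantP F n)) _.
by rewrite lerD2l invf_le1 ?ler1n ?ltr0n.
Qed.

Lemma rkhs_dotC F (F' : H) : rkhs_dot F' F = (rkhs_dot F F')^*.
Proof.
apply: rate_cvg_unique (gram_rate_cvg F' F) _.
rewrite [X in rate_cvg X](_ : _ = fun n =>
    (gram K (approximant F n) (approximant F' n))^*).
  exact: rate_cvg_conj (gram_rate_cvg F F').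
by apply/funext => n; rewrite -gramC.
Qed.

Lemma rkhs_dot_ge0 F : 0 <= rkhs_dot F F.
Proof. by apply: rate_cvg_ge0 (gram_rate_cvg F F) => n; exact: gram_ge0. Qed.

Lemma rkhs_dotDr F (F1 F2 : H) :
  rkhs_dot F (F1 + F2) = rkhs_dot F F1 + rkhs_dot F F2.
Proof. by rewrite -[F1]scale1r rkhs_dot_linear mul1r scale1r. Qed.

Lemma rkhs_dot0r F : rkhs_dot F 0 = 0.
Proof. by apply: (addrI (rkhs_dot F 0)); rewrite -rkhs_dotDr !addr0. Qed.

Lemma rkhs_dotZr c F (F' : H) : rkhs_dot F (c *: F') = c * rkhs_dot F F'.
Proof. by rewrite -[c *: F']addr0 rkhs_dot_linear rkhs_dot0r addr0. Qed.

Lemma rkhs_dotDl F (F1 F2 : H) :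
  rkhs_dot (F1 + F2) F = rkhs_dot F1 F + rkhs_dot F2 F.
Proof. by rewrite rkhs_dotC rkhs_dotDr rmorphD /= -!rkhs_dotC. Qed.

Lemma rkhs_dotZl c F (F' : H) : rkhs_dot (c *: F') F = c^* * rkhs_dot F' F.
Proof. by rewrite rkhs_dotC rkhs_dotZr rmorphM /= -rkhs_dotC. Qed.

Definition rkhs_norm F := sqrtC (rkhs_dot F F).

Lemma rkhs_norm_ge0 F : 0 <= rkhs_norm F.
Proof. by rewrite sqrtC_ge0 rkhs_dot_ge0. Qed.

Lemma rkhs_norm_sqr F : rkhs_norm F ^+ 2 = rkhs_dot F F.
Proof. exact: sqrtCK. Qed.

Lemma rkhs_cauchy_schwarz F (F' : H) :
  `|rkhs_dot F F'| <= rkhs_norm F * rkhs_norm F'.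
Proof.
rewrite -(@ler_pXn2r _ 2) ?nnegrE ?mulr_ge0 ?rkhs_norm_ge0 // exprMn.
rewrite !rkhs_norm_sqr.
apply: psd_scalar_cauchy_schwarz; rewrite ?rkhs_dot_ge0 // => c.
have := rkhs_dot_ge0 (F + c *: F').
rewrite rkhs_dotDl !rkhs_dotDr !rkhs_dotZl !rkhs_dotZr [rkhs_dot F' F]rkhs_dotC.
by rewrite normCK; congr (_ <= _); ring.
Qed.

Lemma span_vec_subproof l : span_fun K l \in rkhs_pred K.
Proof.
by apply/rkhs_predP => e e0; exists l; exact: approximates_le (ltW e0) (@approximates_span _ _ _ _).
Qed.

Definition span_vec l : H := Rkhs (span_vec_subproof l).

Lemma rkhs_dot_span l F : rkhs_dot (span_vec l) F = pairing F l.
Proof.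
apply: (@rate_cvg_unique _ _ (fun=> pairing F l)); last exact: rate_cvg_cst.
apply: pairing_rate_cvg => n.
exact: approximates_le (natSinv_ge0 _ _) (@approximates_span _ _ _ _).
Qed.

(** Together with the next lemma: the norm of the inner product is the dual norm. *)
Lemma dual_le_norm F : dual_le K F (rkhs_norm F).
Proof.
move=> m; rewrite -rkhs_dot_span mulrC.
apply: le_trans (rkhs_cauchy_schwarz _ _) _.
by rewrite /rkhs_norm rkhs_dot_span.
Qed.

Lemma norm_le_dual F M : 0 <= M -> dual_le K F M -> rkhs_norm F <= M.
Proof.
move=> M0 FM; rewrite -(@ler_pXn2r _ 2) ?nnegrE ?rkhs_norm_ge0 // rkhs_norm_sqr.
have [N N0 NP] := pairing_rate_cvg F (approximantP F).
apply: (@le_natSinv _ _ _ (M + N)) => [|n]; first exact: addr_ge0.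
rewrite -[leLHS]ger0_norm ?rkhs_dot_ge0 //.
rewrite -(subrK (pairing F (approximant F n)) (rkhs_dot F F)).
apply: le_trans (ler_normD _ _) _.
have -> : M ^+ 2 + (M + N) / n.+1%:R = N / n.+1%:R + M * (M + n.+1%:R^-1) by ring.
apply: lerD; first by rewrite distrC.
apply: le_trans (FM _) _; rewrite ler_wpM2l //.
exact: (approx_lnorm M0 (natSinv_ge0 _ _) FM (approximantP F n)).
Qed.

Lemma rkhs_ler_normD F (F' : H) :
  rkhs_norm (F + F') <= rkhs_norm F + rkhs_norm F'.
Proof.
rewrite -(@ler_pXn2r _ 2) ?nnegrE ?addr_ge0 ?rkhs_norm_ge0 //.
set z := rkhs_dot F F'.
rewrite sqrrD !rkhs_norm_sqr.
have -> : rkhs_dot (F + F') (F + F') = rkhs_dot F F + (z + z^*) + rkhs_dot F' F'.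
  by rewrite rkhs_dotDl !rkhs_dotDr (rkhs_dotC F F') -/z; ring.
rewrite lerD2r lerD2l mulr2n.
have zr : z + z^* \is Num.real by apply/CrealP; rewrite rmorphD /= conjCK addrC.
apply: le_trans (real_ler_norm zr) _; apply: le_trans (ler_normD _ _) _.
by rewrite norm_conjC lerD // rkhs_cauchy_schwarz.
Qed.

Lemma rkhs_normZ c F : rkhs_norm (c *: F) = `|c| * rkhs_norm F.
Proof.
apply/eqP; rewrite -(@eqrXn2 _ 2) ?mulr_ge0 ?rkhs_norm_ge0 //.
by rewrite exprMn !rkhs_norm_sqr rkhs_dotZl rkhs_dotZr mulrA normCK mulrC [_^* * _]mulrC mulrC.
Qed.

Lemma rkhs_norm0_eq0 F : rkhs_norm F = 0 -> F = 0.
Proof.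
move=> F0; apply: rkhs_eqP => g; rewrite -pairing1.
have := dual_le_norm F [:: (1, g)].
by rewrite F0 mul0r normr_le0 => /eqP.
Qed.

HB.instance Definition _ := @Lmodule_isNormed.Build R[i] (rkhs K)
  rkhs_norm rkhs_ler_normD rkhs_normZ rkhs_norm0_eq0.

Lemma rkhs_normE F : `|F| = rkhs_norm F.
Proof. by []. Qed.

(** A Cauchy filter yields a sequence that converges pointwise on G; by the
    bound of the dual norm the convergence also holds in norm, so the pointwise
    limit can be approximated by formal combinations as well as the terms of
    the sequence. *)
Lemma rkhs_complete (Fl : set_system H) : ProperFilter Fl -> cauchy Fl -> cvg Fl.
Proof.
move=> FF Fc.
have /choice[x xP] : forall n, exists x, Fl (ball x n.+1%:R^-1).
  by have /cauchyP Fx := Fc => n; exact: (Fx _ (natSinv_gt0 n)).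
have x_close n k m :
    `|pairing (x n) m - pairing (x k) m| <= (n.+1%:R^-1 + k.+1%:R^-1) * lnorm K m.
  have [y [xy yx]] := filter_ex (filterI (xP n) (xP k)).
  rewrite -pairingB; apply: le_trans (dual_le_norm (x n - x k) m) _.
  rewrite ler_wpM2r ?lnorm_ge0 // -rkhs_normE -(subrKA y).
  apply: le_trans (ler_normD _ _) _; move: xy yx; rewrite -!ball_normE /ball_ /=.
  by move=> xy yx; rewrite lerD ?ltW // distrC.
(* Norm convergence implies pointwise convergence, by pairing with g. *)
have /choice[L LP] : forall g, exists z : R[i], rate_cvg (fun n => x n g) z.
  move=> g; have [|z zP] := @cauchy_seq_limC _ (fun n => x n g) _
    (lnorm_ge0 K [:: (1, g)]).
    by move=> n k; rewrite -(pairing1 (x n)) -(pairing1 (x k)) mulrC x_close.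
  by exists z, (lnorm K [:: (1, g)]) => //; exact: lnorm_ge0.
have Lx n : dual_le K ((L : G -> R[i]^o) - x n) n.+1%:R^-1.
  move=> m; rewrite pairingB.
  have [N N0 NP] : rate_cvg (fun k => pairing (x k) m) (pairing L m).
    by apply: rate_cvg_sum => p; exact: rate_cvgMl.
  apply: (@le_natSinv _ _ _ (lnorm K m + N)) => [|k].
    by rewrite addr_ge0 ?lnorm_ge0.
  rewrite -(subrKA (pairing (x k) m)); apply: le_trans (ler_normD _ _) _.
  have -> : n.+1%:R^-1 * lnorm K m + (lnorm K m + N) / k.+1%:R =
      N / k.+1%:R + (k.+1%:R^-1 + n.+1%:R^-1) * lnorm K m by ring.
  by apply: lerD; [rewrite distrC|exact: x_close].
have L_rkhs : (L : G -> R[i]^o) \in rkhs_pred K.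
  apply/rkhs_predP => e e0; have e2 : 0 < e / 2 by rewrite divr_gt0 // ltr0n.
  have [N /(_ N (leqnn N)) NP] := natSinv_ltC e2.
  have [l lP] := approximates_ex (x N) e2.
  pose xN : G -> R[i]^o := x N.
  exists l => m; rewrite -(subrKA xN).
  have -> : pairing ((L : G -> R[i]^o) - xN + (xN - span_fun K l)) m =
      pairing ((L : G -> R[i]^o) - xN) m + pairing (xN - span_fun K l) m.
    by rewrite -[X in pairing (X + _)]scale1r pairing_linear mul1r.
  rewrite [e in leRHS]splitr mulrDl; apply: le_trans (ler_normD _ _) _.
  apply: lerD (lP m); apply: le_trans (Lx N m) _.
  by rewrite ler_wpM2r ?lnorm_ge0 // ltW.
pose L' : H := Rkhs L_rkhs.
have Ln n : `|L' - x n| <= n.+1%:R^-1.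
  by rewrite rkhs_normE; apply: norm_le_dual; [exact: natSinv_ge0|exact: Lx].
apply/cvg_ex; exists L' => U /nbhs_ballP[e /= e0 eU].
have e2 : 0 < e / 2 by rewrite divr_gt0 // ltr0n.
have [N /(_ N (leqnn N)) NP] := natSinv_ltC e2.
apply: filterS (xP N) => y; rewrite -ball_normE /ball_ /= => xy; apply: eU.
rewrite -ball_normE /ball_ /= -(subrKA (x N)) [e]splitr.
apply: le_lt_trans (ler_normD _ _) _.
by rewrite ltrD // (le_lt_trans (Ln N), lt_trans xy).
Qed.

HB.instance Definition _ := Uniform_isComplete.Build (rkhs K) rkhs_complete.

Lemma rkhs_dot_norm F : rkhs_dot F F = `|F| ^+ 2.
Proof. by rewrite rkhs_normE rkhs_norm_sqr. Qed.

HB.instance Definition _ := CompleteNormedModule_isHilbert.Build R (rkhs K)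
  rkhs_dotDr (fun c F F' => rkhs_dotZr c F F') rkhs_dotC rkhs_dot_norm.

End RkhsHilbert.

Section KernelEvaluation.
Variables (R : realType) (G : Type) (K : pd_kernel R G).

Definition kernel_vec g : rkhs K := span_vec K [:: (1, g)].

Lemma kernel_vecE g h : kernel_vec g h = K h g.
Proof. by rewrite /kernel_vec /= /span_fun big_seq1 mul1r. Qed.

(** The reproducing property.  It turns evaluation into an inner product, so
    identities between kernel vectors follow from those of the kernel. *)
Lemma reproducing g (F : rkhs K) : hdot (kernel_vec g) F = F g.
Proof. by rewrite /hdot /= rkhs_dot_span pairing1. Qed.

Lemma kernel_vec_total (F : rkhs K) : adherent (lspan (range kernel_vec)) F.
Proof.
move=> e e0; have e2 : 0 < e / 2 by rewrite divr_gt0 // ltr0n.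
have [l lP] := approximates_ex F e2; exists (span_vec K l); last first.
  apply: (@le_lt_trans _ _ (e / 2)).
    by rewrite rkhs_normE; apply: norm_le_dual; [exact: ltW|exact: lP].
  by rewrite [ltRHS]splitr ltrDl.
exists (size l), (fun i => (tnth (in_tuple l) i).1),
  (fun i => kernel_vec (tnth (in_tuple l) i).2); split => [i|]; first by eexists.
apply: rkhs_eqP => g.
rewrite -[RHS]reproducing.
rewrite (big_morph (hdot (kernel_vec g)) (hdotDr _) (hdot0r _)).
rewrite /= /span_fun (big_tnth _ _ l); apply: eq_bigr => i _.
by rewrite hdotZr reproducing kernel_vecE.
Qed.

(** F o f' is the image of F under the adjoint of the operator that maps the
    symbol g to f' g.  That operator exists on formal combinations with bound t,
    and composition with f' is compatible with dual norms and, thanks to the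
    adjoint f on symbols, with functions of formal combinations. *)
Lemma composition_operator (f f' : G -> G) (t : R[i]) : 0 <= t ->
    (forall g h, K (f' g) h = K g (f h)) ->
    (forall l, gram K [seq (p.1, f' p.2) | p <- l] [seq (p.1, f' p.2) | p <- l]
       <= t ^+ 2 * gram K l l) ->
  exists T : 'L(rkhs K), forall F g, T F g = F (f' g).
Proof.
move=> t0 adj bnd.
pose push (h : G -> G) (l : seq (R[i] * G)) := [seq (p.1, h p.2) | p <- l].
have pairing_push (F : G -> R[i]^o) m : pairing (F \o f') m = pairing F (push f' m).
  by rewrite /pairing big_map.
have lnorm_push m : lnorm K (push f' m) <= t * lnorm K m.
  rewrite -(@ler_pXn2r _ 2) ?nnegrE ?mulr_ge0 ?lnorm_ge0 //.
  by rewrite exprMn !lnorm_sqr; exact: bnd.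
have dual_push (F : G -> R[i]^o) M : 0 <= M -> dual_le K F M ->
    dual_le K (F \o f') (t * M).
  move=> M0 FM m; rewrite pairing_push; apply: le_trans (FM _) _.
  by rewrite [t * M]mulrC -mulrA ler_wpM2l.
have Trkhs (F : rkhs K) : (F \o f' : G -> R[i]^o) \in rkhs_pred K.
  apply/rkhs_predP => e e0; have t1 : 0 < t + 1 by rewrite ltr_wpDl.
  have [l lP] := approximates_ex F (divr_gt0 e0 t1); exists (push f l).
  have e1 := ltW (divr_gt0 e0 t1).
  apply: approximates_le (_ : t * (e / (t + 1)) <= e) _.
    rewrite mulrCA -[leRHS]mulr1 ler_wpM2l ?(ltW e0) //.
    by rewrite ler_pdivrMr // mul1r lerDl.
  rewrite /approximates; have -> : span_fun K (push f l) = span_fun K l \o f'.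
    apply/funext => g; rewrite /span_fun big_map /=.
    by apply: eq_bigr => q _; rewrite adj.
  exact: dual_push e1 lP.
pose T (F : rkhs K) := Rkhs (Trkhs F).
suff TB : T \in @bounded_op R (rkhs K) (rkhs K) by exists (BoundedOp TB).
apply/bounded_opP; split=> [k F F'|]; first exact: rkhs_eqP.
exists t => F; rewrite !rkhs_normE; apply: norm_le_dual.
  by rewrite mulr_ge0 ?rkhs_norm_ge0.
by apply: dual_push; [exact: rkhs_norm_ge0|exact: dual_le_norm].
Qed.

End KernelEvaluation.

(** * The interior tensor product representation *)

Section InteriorTensor.
Variables (R : realType) (A B : cstarAlgType R) (X : correspondence A B).
Variables (H0 : hilbertType R) (rho : B -> 'L(H0)).
Hypotheses (rho_hom : star_hom rho) (rho_nondeg : acts_nondegenerately rho).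
Implicit Types (a : A) (x y : X) (h k : H0) (u v : X * H0).

Let form := @interior_form R B X H0 rho.

Lemma interior_form_herm u v : form v u = (form u v)^*.
Proof. by rewrite /form /interior_form -hdotC rep_adjoint // -bdotC. Qed.

Lemma interior_kernel_ge0 (l : seq (R[i] * (X * H0))) :
  0 <= \sum_(p <- l) \sum_(q <- l) p.1^* * q.1 * form p.2 q.2.
Proof.
have := interior_form_gram_ge0 rho_hom rho_nondeg
  [seq (p.2.1, p.1 *: p.2.2) | p <- l].
rewrite big_map; under eq_bigr do rewrite big_map.
congr (_ <= _); apply: eq_bigr => p _; apply: eq_bigr => q _.
by rewrite /form /interior_form /= linearZ hdotZl hdotZr mulrA.
Qed.

Definition interior_kernel := PdKernel interior_form_herm interior_kernel_ge0.

Let K := interior_kernel.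
Lemma interior_kernelE u v : K u v = hdot u.2 (rho (bdot u.1 v.1) v.2).
Proof. by []. Qed.

Let act a u : X * H0 := (corr_act X a u.1, u.2).

Lemma interior_form_act a u v : form (act a u) v = form u (act (star a) v).
Proof.
rewrite /form /interior_form /=; case: (corr_act_star_hom X) => _ _ ->.
by rewrite adjointableOp_starE -madjointE.
Qed.

Lemma left_actM a b u : act (amul a b) u = act a (act b u).
Proof. by rewrite /act; case: (corr_act_star_hom X) => _ -> _. Qed.

Lemma interior_form_act_linear u c a b v :
  form u (act (c *: a + b) v) = c * form u (act a v) + form u (act b v).
Proof.
rewrite /form /interior_form /=; case: (corr_act_star_hom X) => -> _ _.
by rewrite adjointableOpDE adjointableOpZE bdotDr bdotZr rep_linear // hdotDr hdotZr.
Qed.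

(** For a combination l of tensors, b |-> <l, b l> is a functional on A for which
    <l, l> acts as the value at a unit: its value on (1 - c)* (1 - c) is
    <l - c l, l - c l>, which is nonnegative by positivity of the kernel. *)
Lemma gram_act_le a t (l : seq (R[i] * (X * H0))) : `|a| < t ->
  gram K [seq (p.1, act a p.2) | p <- l] [seq (p.1, act a p.2) | p <- l]
    <= t ^+ 2 * gram K l l.
Proof.
move=> at_; pose push b (m : seq (R[i] * (X * H0))) := [seq (p.1, act b p.2) | p <- m].
have gramE m n : gram K m n = \sum_(p <- m) \sum_(q <- n) p.1^* * q.1 * form p.2 q.2.
  rewrite /gram /pairing /span_fun; apply: eq_bigr => p _.
  by rewrite mulr_sumr; apply: eq_bigr => q _; rewrite mulrA.
have push_adj b m n : gram K (push b m) n = gram K m (push (star b) n).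
  rewrite !gramE big_map; apply: eq_bigr => p _; rewrite big_map.
  by apply: eq_bigr => q _; rewrite interior_form_act.
have pushM b c m : push b (push c m) = push (amul b c) m.
  by rewrite /push -map_comp; apply: eq_map => p /=; rewrite left_actM.
rewrite -!/(push a l) push_adj pushM.
apply: (@positive_functional_bound _ _ (fun b => gram K l (push b l))) at_.
  move=> c b b'; rewrite !gramE mulr_sumr -big_split; apply: eq_bigr => p _ /=.
  rewrite !big_map mulr_sumr -big_split; apply: eq_bigr => q _ /=.
  by rewrite interior_form_act_linear; ring.
move=> c; have := gram_ge0 K (lcomb (-1) (push c l) l).
rewrite gram_lcombl !gram_lcombr !push_adj pushM rmorphN rmorph1.
by congr (_ <= _); ring.
Qed.

(** The star is there because F is a function of its first argument through the
    inner product: <u, a F> = <a* u, F>. *)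
Lemma left_action_ex a : exists T : 'L(rkhs K), forall F u, T F u = F (act (star a) u).
Proof.
apply: (@composition_operator _ _ _ (act a) (act (star a)) (`|star a| + 1)).
- by rewrite addr_ge0.
- by move=> u v; rewrite [LHS]interior_form_act starK.
- by move=> l; apply: gram_act_le; rewrite ltrDl.
Qed.

Definition left_action a : 'L(rkhs K) := projT1 (cid (left_action_ex a)).

Lemma left_actionE a F u : left_action a F u = F (act (star a) u).
Proof. exact: (projT2 (cid (left_action_ex a))). Qed.

Lemma left_action_kernel_vec a u :
  left_action a (kernel_vec K u) = kernel_vec K (act a u).
Proof.
apply: rkhs_eqP => v; rewrite left_actionE !kernel_vecE.
by rewrite [LHS]interior_form_act starK.
Qed.

Lemma left_action_star_hom : star_hom left_action.
Proof.
split=> [c a b|a b|a].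
- apply: boundedOpP => F; apply: rkhs_eqP => u.
  rewrite -[RHS]reproducing boundedOpDE boundedOpZE hdotDr hdotZr.
  rewrite !reproducing !left_actionE -![F _]reproducing.
  rewrite -[c in RHS]conjCK -hdotZl -hdotDl; congr hdot.
  apply: rkhs_eqP => v; rewrite -[RHS]reproducing hdotDr hdotZr !reproducing !kernel_vecE.
  by rewrite starD starZ; exact: interior_form_act_linear.
- apply: boundedOpP => F; apply: rkhs_eqP => u.
  by rewrite boundedOp_amulE !left_actionE starM left_actM.
- apply: boundedOpP => F; apply: rkhs_eqP => u.
  rewrite -[RHS]reproducing boundedOp_starE -adjointE.
  by rewrite left_action_kernel_vec reproducing left_actionE starK.
Qed.

Lemma kernel_vec_linear_left c x y h :
  kernel_vec K (c *: x + y, h) = c *: kernel_vec K (x, h) + kernel_vec K (y, h).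
Proof.
apply: rkhs_eqP => u.
rewrite -[RHS]reproducing hdotDr hdotZr !reproducing !kernel_vecE.
rewrite !interior_kernelE /= bdotDr bdotZr rep_linear //.
by rewrite hdotDr hdotZr.
Qed.

Lemma kernel_vec_linear_right c x h k :
  kernel_vec K (x, c *: h + k) = c *: kernel_vec K (x, h) + kernel_vec K (x, k).
Proof.
apply: rkhs_eqP => u.
rewrite -[RHS]reproducing hdotDr hdotZr !reproducing !kernel_vecE.
by rewrite !interior_kernelE /= linearP hdotDr hdotZr.
Qed.

(** The squared norm of x (x) h is <h, rho(<x, x>) h>, and rho is contractive. *)
Lemma kernel_vec_norm_le x h : `|kernel_vec K (x, h)| <= `|x| * `|h|.
Proof.
rewrite -(@ler_pXn2r _ 2) ?nnegrE ?mulr_ge0 // -hdot_norm reproducing kernel_vecE.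
rewrite !interior_kernelE /=; set T := hdot _ _.
have -> : T = `|T|.
  by rewrite ger0_norm // /T; have [c ->] := bdot_ge0 x;
     rewrite rep_mul // -rep_adjoint // hdot_norm exprn_ge0.
apply: le_trans (cauchy_schwarz _ _) _.
rewrite exprMn -bdot_norm [_ * `|h| ^+ 2]mulrC expr2 -mulrA ler_wpM2l //.
by rewrite mulrC rep_contractive.
Qed.

Lemma creation_subproof x : (fun h => kernel_vec K (x, h)) \in @bounded_op R H0 (rkhs K).
Proof.
apply/bounded_opP; split=> [c h k|]; first exact: kernel_vec_linear_right.
by exists `|x| => h; exact: kernel_vec_norm_le.
Qed.

(** The operator h |-> x (x) h. *)
Definition creation x : 'L(H0, rkhs K) := BoundedOp (creation_subproof x).

Lemma interior_representation : corr_representation left_action rho creation.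
Proof.
split=> //.
- exact: left_action_star_hom.
- by move=> c x y; apply: boundedOpP => h; exact: kernel_vec_linear_left.
- by move=> a x; apply: boundedOpP => h; rewrite /= left_action_kernel_vec.
- move=> x b; apply: boundedOpP => h; apply: rkhs_eqP => u.
  by rewrite !kernel_vecE !interior_kernelE /= bdot_ract rep_mul.
- move=> x y; apply: boundedOpP => h; apply: hdot_inj => k.
  by rewrite /= -adjointE /= reproducing kernel_vecE interior_kernelE.
Qed.

(** If x is close to a combination of elements a y, then x (x) h is close to the
    same combination of the a (y (x) h). *)
Lemma left_action_nondegenerate :
  acts_nondegenerately (corr_act X) -> acts_nondegenerately left_action.
Proof.
move=> /denseP X_nondeg; apply/denseP => F.
set D := lspan _.
have Dadh x h : adherent D (kernel_vec K (x, h)).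
  move=> e e0; have h1 : 0 < `|h| + 1 by rewrite ltr_wpDl.
  have [x' x'D xx'] := X_nondeg x _ (divr_gt0 e0 h1).
  exists (kernel_vec K (x', h)).
    apply: (lspan_min (P := [set y | D (kernel_vec K (y, h))])) x'D => /=.
    - have := kernel_vec_linear_left (-1) 0 0 h.
      rewrite scaler0 addr0 scaleN1r addNr => ->.
      exact: lspan0.
    - by move=> c y z yD zD; rewrite kernel_vec_linear_left; exact: lspan_linear.
    move=> _ [a [y ->]]; apply: sub_lspan.
    by exists a, (kernel_vec K (y, h)); rewrite left_action_kernel_vec.
  have -> : kernel_vec K (x, h) - kernel_vec K (x', h) = kernel_vec K (x - x', h).
    have := kernel_vec_linear_left (-1) x' x h.
    by rewrite !scaleN1r [- x' + x]addrC => ->; rewrite addrC.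
  apply: le_lt_trans (kernel_vec_norm_le _ _) _.
  apply: (@le_lt_trans _ _ (`|x - x'| * (`|h| + 1))).
    by rewrite ler_wpM2l // lerDl.
  by rewrite -ltr_pdivlMr.
apply: (adherent_trans _ (kernel_vec_total F)) => w.
apply: (lspan_min (P := [set w | adherent D w])) => /=.
- exact/sub_adherent/lspan0.
- by move=> c y z; apply: adherent_linear; exact: lspan_linear.
- by move=> _ [[x h] _ <-]; exact: Dadh.
Qed.

End InteriorTensor.

Theorem theorem4p3 (R : realType) (A B : cstarAlgType R)
    (X : correspondence A B) (H0 : hilbertType R) (rho : B -> 'L(H0))
    (rho_hom : star_hom rho) (rho_nondeg : acts_nondegenerately rho) :
  exists (H1 : hilbertType R) (lam : A -> 'L(H1)) (piX : X -> 'L(H0, H1)),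
    [/\ exists M : R[i], forall x, opnorm_le (piX x) (M * `|x|),
        corr_representation lam rho piX &
        acts_nondegenerately (corr_act X) -> acts_nondegenerately lam].
Proof.
exists (rkhs (interior_kernel X rho_hom rho_nondeg)).
exists (left_action X rho_hom rho_nondeg), (creation rho_hom rho_nondeg); split.
- exists 1 => x h; rewrite mul1r.
  exact: kernel_vec_norm_le.
- exact: interior_representation.
- exact: left_action_nondegenerate.
Qed.
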